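(* Let $\Gamma$ be an abelian group, $A$ a $\Gamma$-graded field, and let $R$ and $S$ be $\Gamma$-graded ultramatricial algebras over $A$. Then $R$ and $S$ are isomorphic as graded $A$-algebras if and only if there is an order preserving $\mathbb{Z}[\Gamma]$-module isomorphism $$\big(K_0^{\mathrm{gr}}(R),[R]\big)\;\cong\;\big(K_0^{\mathrm{gr}}(S),[S]\big).$$
   Context: Rings have identity, homomorphisms preserve it, modules are right modules; $\Gamma$ is written additively. A $\Gamma$-graded field is a commutative $\Gamma$-graded ring in which every nonzero homogeneous element is invertible. For $\overline{\delta}=(\delta_1,\dots,\delta_n)\in\Gamma^n$, $\mathbb{M}_n(A)(\overline{\delta})$ is the matrix ring $\mathbb{M}_n(A)$ with the $\Gamma$-grading whose component of degree $\lambda$ consists of the matrices with $(i,j)$-entry in $A_{\lambda+\delta_j-\delta_i}$. A $\Gamma$-graded matricial $A$-algebra is a graded $A$-algebra of the form $\mathbb{M}_{n_1}(A)(\overline{\delta}_1)\times\dots\times\mathbb{M}_{n_l}(A)(\overline{\delta}_l)$ (components of the product graded componentwise). A $\Gamma$-graded ultramatricial $A$-algebra is a graded $A$-algebra $R=\bigcup_{i=1}^\infty R_i$ with $R_1\subseteq R_2\subseteq\cdots$ a sequence of graded matricial $A$-subalgebras, the inclusions respecting the grading and the identities. Graded homomorphisms preserve degrees. For a $\Gamma$-graded ring $R$, $K_0^{\mathrm{gr}}(R)$ is the group completion of the monoid (under $\oplus$) of graded isomorphism classes $[P]$ of graded finitely generated projective right $R$-modules, with $\mathbb{Z}[\Gamma]$-module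 structure $\alpha[P]=[P(\alpha)]$, where $P(\alpha)_\gamma=P_{\alpha+\gamma}$. Its positive cone $K_0^{\mathrm{gr}}(R)_+$ is the set of classes $[P]$ of graded finitely generated projective modules. An order preserving isomorphism $(K_0^{\mathrm{gr}}(R),[R])\cong(K_0^{\mathrm{gr}}(S),[S])$ is a $\mathbb{Z}[\Gamma]$-module isomorphism sending the positive cone onto the positive cone and $[R]$ to $[S]$. *)

(* Defs.v *)
From HB Require Import structures.
From mathcomp Require Import all_boot all_order all_algebra.
From mathcomp Require Import finmap.
From mathcomp Require Import boolp classical_sets.

Set Implicit Arguments.
Unset Strict Implicit.
Unset Printing Implicit Defensive.

Import GRing.Theory.
Local Open Scope classical_set_scope.
Local Open Scope ring_scope.

Section Grading.
Variables (Gam : zmodType) (V : zmodType).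

Definition homogeneous (D : Gam -> set V) (x : V) : Prop := exists a, D a x.

(* [V] is the internal direct sum of the subgroups [D a]. *)
Record is_grading (D : Gam -> set V) : Prop := IsGrading {
  grading0 : forall a, D a 0;
  gradingB : forall a x y, D a x -> D a y -> D a (x - y);
  grading_span : forall x, exists s : seq V,
    (forall v, v \in s -> homogeneous D v) /\ x = \sum_(v <- s) v;
  grading_indep : forall (s : seq Gam) (v : Gam -> V), uniq s ->
    (forall a, D a (v a)) -> \sum_(a <- s) v a = 0 ->
    forall a, a \in s -> v a = 0 }.

Record grading := Grading {
  gcomp :> Gam -> set V;
  gcompP : is_grading gcomp }.

Lemma gcompN (D : grading) a x : D a x -> D a (- x).
Proof.
by move=> Dx; rewrite -sub0r; apply: gradingB (gcompP D) _ _ _ (grading0 (gcompP D) a) Dx.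
Qed.

Lemma gcompD (D : grading) a x y : D a x -> D a y -> D a (x + y).
Proof.
by move=> Dx Dy; rewrite -[y]opprK; apply: gradingB (gcompP D) _ _ _ Dx (gcompN Dy).
Qed.

Lemma homogeneous_decomp (D : grading) x : exists (s : seq Gam) (v : Gam -> V),
  [/\ uniq s, forall a, D a (v a) & x = \sum_(a <- s) v a].
Proof.
have [t [ht ->]] := grading_span (gcompP D) x.
elim: t ht => [|w t IHt] ht.
  exists [::], (fun=> 0); split=> //; last by rewrite !big_nil.
  by move=> a; apply: grading0 (gcompP D) a.
have {}IHt := IHt (fun u ut => ht u (mem_behead (s := w :: t) ut)).
have [s [v [us hv es]]] := IHt.
have [b Db] := ht w (mem_head _ _); rewrite big_cons es.
pose v' c := if c == b then w + (if b \in s then v b else 0) else v c.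
have hv' c : D c (v' c).
  rewrite /v'; case: eqP => [->|//]; apply: gcompD => //.
  by case: ifP => // _; apply: grading0 (gcompP D) b.
case bs: (b \in s).
  exists s, v'; split=> //.
  rewrite (bigD1_seq b) //= [RHS](bigD1_seq b) //= {1}/v' eqxx bs addrA.
  by congr (_ + _); apply: eq_bigr => c /negPf cb; rewrite /v' cb.
exists (b :: s), v'; split=> //; first by rewrite /= bs.
rewrite big_cons {1}/v' eqxx bs addr0; congr (_ + _).
apply: eq_big_seq => c cs; rewrite /v'; case: eqP cs => // ->.
by rewrite bs.
Qed.

Lemma homogeneous_sum (D : grading) b y (s : seq Gam) (v : Gam -> V) :
  uniq s -> (forall a, D a (v a)) -> D b y -> y = \sum_(a <- s) v a ->
  y = if b \in s then v b else 0.
Proof.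
move=> us hv Db ey; case bs: (b \in s).
  pose v' a := v a - (if a == b then y else 0).
  have hv' a : D a (v' a).
    apply: gradingB (gcompP D) _ _ _ (hv a) _.
    by case: eqP => [->|_] //; apply: grading0 (gcompP D) a.
  have /(_ _ b bs) := grading_indep (gcompP D) us hv'.
  rewrite /v' eqxx => h; apply/esym/eqP; rewrite -subr_eq0; apply/eqP/h.
  rewrite big_split /= -ey (bigD1_seq b) //= eqxx big1 ?addr0 ?subrr // => a /negPf ->.
  by rewrite oppr0.
pose v' a := if a == b then - y else v a.
have hv' a : D a (v' a) by rewrite /v'; case: eqP => [->|_] //; apply: gcompN.
have ubs : uniq (b :: s) by rewrite /= bs.
have := grading_indep (gcompP D) ubs hv' _ (mem_head b s).
rewrite /v' eqxx => h; apply/eqP; rewrite -oppr_eq0; apply/eqP/h.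
rewrite big_cons eqxx {1}ey addrC; apply/eqP; rewrite subr_eq0; apply/eqP.
by apply: eq_big_seq => a as_; case: eqP as_ => // ->; rewrite bs.
Qed.

End Grading.

Record ring_grading (Gam : zmodType) (R : pzRingType) := RingGrading {
  rgrading :> grading Gam R;
  rgradingM : forall a b (x y : R),
    rgrading a x -> rgrading b y -> rgrading (a + b) (x * y) }.

Lemma rgrading1 (Gam : zmodType) (R : pzRingType) (G : ring_grading Gam R) :
  G 0 1.
Proof.
have [s [v [us hv e1]]] := homogeneous_decomp G 1.
pose e := if 0 \in s then v 0 else 0.
have Ge : G 0 e by rewrite /e; case: ifP => // _; apply: grading0 (gcompP G) 0.
suff he x : x = x * e by rewrite [X in G 0 X]he mul1r.
have [t [ht ->]] := grading_span (gcompP G) x.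
rewrite mulr_suml; apply: eq_big_seq => y /ht [b Gy].
have ey : y = \sum_(c <- [seq b + a | a <- s]) y * v (c - b).
  rewrite big_map -[LHS]mulr1 e1 mulr_sumr; apply: eq_bigr => a _.
  by rewrite addrAC subrr add0r.
have uq : uniq [seq b + a | a <- s] by rewrite map_inj_uniq //; apply: addrI.
have hw c : G c (y * v (c - b)).
  by rewrite -[c in G c](addrNK b) addrC; apply: rgradingM.
have := homogeneous_sum uq hw Gy ey.
rewrite -{1}[b]addr0 mem_map; last exact: addrI.
by rewrite /e subrr; case: ifP => _ //; rewrite mulr0.
Qed.

Record alg_grading (Gam : zmodType) (A : comNzRingType)
    (gA : ring_grading Gam A) (R : algType A) := AlgGrading {
  agrading :> ring_grading Gam R;
  agradingZ : forall a b (c : A) (x : R),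
    gA a c -> agrading b x -> agrading (a + b) (c *: x) }.

(* The ambient type already makes [A] commutative with [1 != 0]. *)
Definition graded_field (Gam : zmodType) (A : comNzRingType)
    (gA : ring_grading Gam A) : Prop :=
  forall (a : Gam) (x : A), gA a x -> x != 0 -> exists y : A, x * y = 1.

Definition graded_alg_iso (Gam : zmodType) (A : comNzRingType)
    (gA : ring_grading Gam A) (R S : algType A)
    (gR : alg_grading gA R) (gS : alg_grading gA S) : Prop :=
  exists f : {lrmorphism R -> S},
    bijective f /\ forall a x, gS a (f x) <-> gR a x.

(* The product algebra M_(n_0 + 1)(A) x ... x M_(n_l + 1)(A): there is at least
   one factor, and each factor has positive size.  The operations are
   pointwise. *)
Definition mprod (A : comNzRingType) (l : nat) (n : 'I_l.+1 -> nat) : Type :=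
  forall k : 'I_l.+1, 'M[A]_((n k).+1).

Section MatrixProduct.
Variables (A : comNzRingType) (l : nat) (n : 'I_l.+1 -> nat).
Local Notation T := (mprod A n).
Implicit Types x y z : T.

HB.instance Definition _ := Choice.copy T (forall k : 'I_l.+1, 'M[A]_((n k).+1)).

Let padd x y : T := fun k => x k + y k.
Let pzero : T := fun=> 0.
Let popp x : T := fun k => - x k.
Let pmul x y : T := fun k => x k * y k.
Let pone : T := fun=> 1.
Let pscale (c : A) x : T := fun k => c *: x k.

Fact mprod_addA : associative padd.
Proof. by move=> x y z; apply: functional_extensionality_dep => k; apply: addrA. Qed.
Fact mprod_addC : commutative padd.
Proof. by move=> x y; apply: functional_extensionality_dep => k; apply: addrC. Qed.
Fact mprod_add0 : left_id pzero padd.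
Proof. by move=> x; apply: functional_extensionality_dep => k; apply: add0r. Qed.
Fact mprod_addN : left_inverse pzero popp padd.
Proof. by move=> x; apply: functional_extensionality_dep => k; apply: addNr. Qed.
HB.instance Definition _ :=
  GRing.isZmodule.Build T mprod_addA mprod_addC mprod_add0 mprod_addN.

Fact mprod_mulA : associative pmul.
Proof. by move=> x y z; apply: functional_extensionality_dep => k; apply: mulrA. Qed.
Fact mprod_mul1 : left_id pone pmul.
Proof. by move=> x; apply: functional_extensionality_dep => k; apply: mul1r. Qed.
Fact mprod_mulr1 : right_id pone pmul.
Proof. by move=> x; apply: functional_extensionality_dep => k; apply: mulr1. Qed.
Fact mprod_mulDl : left_distributive pmul +%R.
Proof. by move=> x y z; apply: functional_extensionality_dep => k; apply: mulrDl. Qed.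
Fact mprod_mulDr : right_distributive pmul +%R.
Proof. by move=> x y z; apply: functional_extensionality_dep => k; apply: mulrDr. Qed.
Fact mprod_neq0 : pone != 0.
Proof.
apply/eqP => /(congr1 (fun x : T => x ord0)) e10.
by have /eqP := oner_neq0 'M[A]_((n ord0).+1); apply.
Qed.
HB.instance Definition _ := GRing.Zmodule_isNzRing.Build T
  mprod_mulA mprod_mul1 mprod_mulr1 mprod_mulDl mprod_mulDr mprod_neq0.

Fact mprod_scaleA a b x : pscale a (pscale b x) = pscale (a * b) x.
Proof. by apply: functional_extensionality_dep => k; apply: scalerA. Qed.
Fact mprod_scale1 : left_id 1 pscale.
Proof. by move=> x; apply: functional_extensionality_dep => k; apply: scale1r. Qed.
Fact mprod_scaleDr : right_distributive pscale +%R.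
Proof. by move=> a x y; apply: functional_extensionality_dep => k; apply: scalerDr. Qed.
Fact mprod_scaleDl x : {morph pscale^~ x : a b / a + b}.
Proof. by move=> a b; apply: functional_extensionality_dep => k; apply: scalerDl. Qed.
HB.instance Definition _ := GRing.Zmodule_isLmodule.Build A T
  mprod_scaleA mprod_scale1 mprod_scaleDr mprod_scaleDl.

Fact mprod_scaleAl (a : A) (x y : T) : a *: (x * y) = (a *: x) * y.
Proof. by apply: functional_extensionality_dep => k; apply: scalerAl. Qed.
HB.instance Definition _ :=
  GRing.LSemiModule_isLSemiAlgebra.Build A T mprod_scaleAl.

Fact mprod_scaleAr (a : A) (x y : T) : a *: (x * y) = x * (a *: y).
Proof. by apply: functional_extensionality_dep => k; apply: scalerAr. Qed.
HB.instance Definition _ :=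
  GRing.LSemiAlgebra_isSemiAlgebra.Build A T mprod_scaleAr.

End MatrixProduct.

Section Ultramatricial.
Variables (Gam : zmodType) (A : comNzRingType) (gA : ring_grading Gam A).

Definition mprod_comp (l : nat) (n : 'I_l.+1 -> nat)
    (delta : forall k : 'I_l.+1, 'I_(n k).+1 -> Gam) (a : Gam) : set (mprod A n) :=
  [set x | forall k i j, gA (a + delta k j - delta k i) (x k i j)].

Variables (R : algType A) (gR : alg_grading gA R).

(* [B] is the image of a unital embedding of graded algebras of a graded
   matricial algebra into [R]: a graded subalgebra containing [1 : R] which, with
   the grading B /\ R_a, is graded isomorphic to that matricial algebra. *)
Definition matricial_subalg (B : set R) : Prop :=
  exists (l : nat) (n : 'I_l.+1 -> nat)
         (delta : forall k : 'I_l.+1, 'I_(n k).+1 -> Gam)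
         (f : {lrmorphism mprod A n -> R}),
    [/\ injective f,
        forall a x, mprod_comp delta a x -> gR a (f x)
      & B = range f].

Definition ultramatricial : Prop :=
  exists B : nat -> set R,
    [/\ forall i, matricial_subalg (B i),
        forall i, B i `<=` B i.+1
      & \bigcup_i B i = setT].

End Ultramatricial.

(* A right [R]-module is a left module over the converse ring [R^c]: for
   [r : R], the vector [(r : R^c) *: x] is x.r . *)
Record gmod (Gam : zmodType) (R : pzRingType) (gR : ring_grading Gam R) := GMod {
  gm_sort :> lmodType R^c;
  gm_gr : grading Gam gm_sort;
  gm_act : forall a b (x : gm_sort) (r : R),
    gm_gr a x -> gR b r -> gm_gr (a + b) ((r : R^c) *: x) }.

Section GradedModules.
Variables (Gam : zmodType) (R : pzRingType) (gR : ring_grading Gam R).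
Local Notation gmod := (gmod gR).
Implicit Types P Q M N : gmod.

Definition graded_hom P Q (f : P -> Q) : Prop :=
  linear f /\ forall a x, gm_gr P a x -> gm_gr Q a (f x).

Definition gmod_iso P Q : Prop :=
  exists f : P -> Q,
    [/\ linear f, bijective f & forall a x, gm_gr Q a (f x) <-> gm_gr P a x].

Definition fingen P : Prop :=
  exists (n : nat) (g : 'I_n -> P), forall x, exists r : 'I_n -> R^c,
    x = \sum_i r i *: g i.

(* Projective object of the category of graded modules. *)
Definition graded_projective P : Prop :=
  forall M N (g : M -> N) (f : P -> N),
    graded_hom g -> (forall y, exists x, g x = y) -> graded_hom f ->
    exists h : P -> M, graded_hom h /\ forall x, g (h x) = f x.

Record gproj := GProj {
  gp_sort :> gmod;
  gp_fg : fingen gp_sort;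
  gp_proj : graded_projective gp_sort }.

End GradedModules.

Section GradedModules.
Variables (Gam : zmodType) (R : pzRingType) (gR : ring_grading Gam R).
Local Notation gmod := (gmod gR).
Local Notation gproj := (gproj gR).
Implicit Types P Q M N : gmod.

Lemma gm_linear0 (U W : lmodType R^c) (f : U -> W) : linear f -> f 0 = 0.
Proof. by move=> lf; have := lf (-1) 0 0; rewrite scaler0 addr0 scaleN1r addNr. Qed.
Lemma gm_linearD (U W : lmodType R^c) (f : U -> W) :
  linear f -> forall x y, f (x + y) = f x + f y.
Proof. by move=> lf x y; have := lf 1 x y; rewrite !scale1r. Qed.
Lemma gm_linearZ (U W : lmodType R^c) (f : U -> W) :
  linear f -> forall a x, f (a *: x) = a *: f x.
Proof. by move=> lf a x; have := lf a x 0; rewrite (gm_linear0 lf) !addr0. Qed.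
Lemma gm_linear_sum (U W : lmodType R^c) (f : U -> W) I (s : seq I) F :
  linear f -> f (\sum_(i <- s) F i) = \sum_(i <- s) f (F i).
Proof. by move=> lf; apply: big_morph; [apply: gm_linearD|apply: gm_linear0]. Qed.

Lemma gmod_iso_refl P : gmod_iso P P.
Proof. by exists id; split=> //; exists id. Qed.

Lemma gmod_iso_sym P Q : gmod_iso P Q -> gmod_iso Q P.
Proof.
move=> [f [lf [g fK gK] hf]]; exists g; split; first 2 last.
- by move=> a x; rewrite -hf gK.
- by move=> a x y; apply: (can_inj fK); rewrite lf !gK.
- by exists f.
Qed.

Lemma gmod_iso_trans P Q N : gmod_iso P Q -> gmod_iso Q N -> gmod_iso P N.
Proof.
move=> [f [lf bf hf]] [g [lg bg hg]]; exists (g \o f); split.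
- by move=> a x y; rewrite /= lf lg.
- exact: bij_comp.
- by move=> a x; rewrite /= hg hf.
Qed.

Fact gmod0_grading : is_grading (fun (_ : Gam) => [set: 'rV[R^c]_0]).
Proof.
by split=> // [x|*]; [exists [::]; split=> //|]; rewrite ?big_nil; apply/rowP; case.
Qed.
Definition gmod0 : gmod :=
  @GMod _ _ gR 'rV[R^c]_0 (Grading gmod0_grading) (fun _ _ _ _ _ _ => I).

Fact gmod0_fg : fingen gmod0.
Proof. by exists 0%N, (fun=> 0) => x; exists (fun=> 0); apply/rowP; case. Qed.
Fact gmod0_proj : graded_projective gmod0.
Proof.
move=> M N g f [lg _] _ [lf _]; exists (fun=> 0); split; first split.
- by move=> a x y; rewrite scaler0 addr0.
- by move=> a x _; apply: grading0 (gcompP (gm_gr M)) a.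
- move=> x; rewrite (gm_linear0 lg); have -> : x = 0 by apply/rowP; case.
  by rewrite (gm_linear0 lf).
Qed.
Definition gproj0 : gproj := GProj gmod0_fg gmod0_proj.

Section DirectSum.
Variables P Q : gmod.

Definition dsum_comp (a : Gam) : set (P * Q)%type :=
  [set x | gm_gr P a x.1 /\ gm_gr Q a x.2].

Fact dsum_grading : is_grading dsum_comp.
Proof.
have [P0 PB Ps Pi] := gcompP (gm_gr P); have [Q0 QB Qs Qi] := gcompP (gm_gr Q).
split=> [a|a x y [? ?] [? ?]|[x y]|s v us hv sv0 a as_].
- by split.
- by split; [apply: PB|apply: QB].
- have [s [hs ->]] := Ps x; have [t [ht ->]] := Qs y.
  exists ([seq (u, 0) | u <- s] ++ [seq (0, u) | u <- t]); split.
    move=> v; rewrite mem_cat => /orP[] /mapP[u uin ->].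
      by have [a Pu] := hs _ uin; exists a; split=> //=; apply: Q0.
    by have [a Qu] := ht _ uin; exists a; split=> //=; apply: P0.
  rewrite big_cat !big_map /=; apply/eqP; rewrite -pair_eqE /=; apply/andP; split.
    by rewrite (raddf_sum (@fst P Q)) (raddf_sum (@fst P Q)) /= big1_eq addr0.
  by rewrite (raddf_sum (@snd P Q)) (raddf_sum (@snd P Q)) /= big1_eq add0r.
- apply/eqP; rewrite -pair_eqE /=; apply/andP; split; apply/eqP.
    apply: (Pi s (fun a => (v a).1)) => // [b|]; first by case: (hv b).
    by rewrite -(raddf_sum (@fst P Q)) sv0.
  apply: (Qi s (fun a => (v a).2)) => // [b|]; first by case: (hv b).
  by rewrite -(raddf_sum (@snd P Q)) sv0.
Qed.

Fact dsum_act a b (x : P * Q) (r : R) :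
  dsum_comp a x -> gR b r -> dsum_comp (a + b) ((r : R^c) *: x).
Proof. by move=> [hx hy] hr; split; apply: gm_act. Qed.

Definition dsum : gmod :=
  @GMod _ _ gR (P * Q)%type (Grading dsum_grading) dsum_act.

Fact dsum_fg : fingen P -> fingen Q -> fingen dsum.
Proof.
move=> [n [g hg]] [m [k hk]].
exists (n + m)%N, (fun i => match split i with inl i => (g i, 0) | inr i => (0, k i) end).
move=> [x y]; have [r ->] := hg x; have [t ->] := hk y.
exists (fun i => match split i with inl i => r i | inr i => t i end).
rewrite big_split_ord /=.
have el (i : 'I_n) : split (lshift m i) = inl i := unsplitK (inl i).
have er (i : 'I_m) : split (rshift n i) = inr i := unsplitK (inr i).
under [X in _ = X + _]eq_bigr do rewrite el.
under [X in _ = _ + X]eq_bigr do rewrite er.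
apply/eqP; rewrite -pair_eqE /=; apply/andP; split.
  rewrite !(raddf_sum (@fst P Q)) /= [X in _ + X]big1 ?addr0 //.
  by move=> i _; rewrite scaler0.
rewrite !(raddf_sum (@snd P Q)) /= [X in X + _]big1 ?add0r //.
by move=> i _; rewrite scaler0.
Qed.

Fact dsum_proj : graded_projective P -> graded_projective Q -> graded_projective dsum.
Proof.
move=> pP pQ M N g f hg sg [lf hf].
have h1 : @graded_hom _ _ gR P N (fun x => f (x, 0)).
  split=> [a x y|a x Px]; first by rewrite -lf; congr f; congr pair; rewrite /= scaler0 addr0.
  by apply: hf; split=> //=; apply: grading0 (gcompP (gm_gr Q)) a.
have h2 : @graded_hom _ _ gR Q N (fun x => f (0, x)).
  split=> [a x y|a x Px]; first by rewrite -lf; congr f; congr pair; rewrite /= scaler0 addr0.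
  by apply: hf; split=> //=; apply: grading0 (gcompP (gm_gr P)) a.
have [u [[lu hu] eu]] := pP _ _ _ _ hg sg h1.
have [w [[lw hw] ew]] := pQ _ _ _ _ hg sg h2.
exists (fun x => u x.1 + w x.2); split; first split.
- by move=> a x y /=; rewrite lu lw scalerDr addrACA.
- by move=> a x [Px Qx]; apply: gcompD; [apply: hu|apply: hw].
- case=> x y /=; rewrite (gm_linearD hg.1) eu ew -(gm_linearD lf); congr f.
  by congr pair; rewrite /= ?addr0 ?add0r.
Qed.

End DirectSum.

Definition gproj_sum (P Q : gproj) : gproj :=
  GProj (dsum_fg (gp_fg P) (gp_fg Q)) (dsum_proj (@gp_proj _ _ _ P) (@gp_proj _ _ _ Q)).

Section Shift.
Variables (al : Gam) (P : gmod).

Definition shift_comp (a : Gam) : set P := gm_gr P (al + a).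

Fact shift_grading : is_grading shift_comp.
Proof.
have [P0 PB Ps Pi] := gcompP (gm_gr P).
split=> [a|a x y|x|s v us hv sv0 a as_]; rewrite /shift_comp; [exact: P0|exact: PB| |].
  have [s [hs ->]] := Ps x; exists s; split=> // v /hs [b Pb].
  by exists (b - al); rewrite addrC addrNK.
pose w b := v (b - al).
have hw b : gm_gr P b (w b) by rewrite -[X in gm_gr P X](addrNK al) addrC; apply: hv.
have us' : uniq [seq al + b | b <- s] by rewrite map_inj_uniq //; apply: addrI.
have ew b : w (al + b) = v b by rewrite /w addrAC subrr add0r.
have := Pi _ w us' hw _ (al + a) (map_f _ as_); rewrite ew; apply.
by rewrite big_map -[RHS]sv0; apply: eq_bigr => b _; rewrite ew.
Qed.

Fact shift_act a b (x : P) (r : R) :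
  shift_comp a x -> gR b r -> shift_comp (a + b) ((r : R^c) *: x).
Proof. by rewrite /shift_comp addrA; apply: gm_act. Qed.

Definition gmod_shift : gmod := @GMod _ _ gR P (Grading shift_grading) shift_act.

End Shift.

Fact shift_fg al P : fingen P -> fingen (gmod_shift al P).
Proof. by []. Qed.

Fact shift_proj al P : graded_projective P -> graded_projective (gmod_shift al P).
Proof.
move=> pP M N g f [lg hg] sg [lf hf].
have h1 : @graded_hom _ _ gR (gmod_shift (- al) M) (gmod_shift (- al) N) g.
  by split=> // a x; apply: hg.
have h2 : @graded_hom _ _ gR P (gmod_shift (- al) N) f.
  split=> // a x Px; apply: hf; rewrite /= /shift_comp addNKr.
  by [].
have [h [[lh hh] eh]] := pP _ _ _ _ h1 sg h2.
exists h; split=> //; split=> // a x Px.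
by have := hh _ _ Px; rewrite /= /shift_comp addKr.
Qed.

Definition gproj_shift (al : Gam) (P : gproj) : gproj :=
  GProj (@shift_fg al _ (gp_fg P)) (@shift_proj al _ (@gp_proj _ _ _ P)).

Definition greg : gmod :=
  @GMod _ _ gR (R^c)^o (@Grading _ (R^c)^o gR (gcompP gR)) (@rgradingM _ _ gR).

Fact greg_fg : fingen greg.
Proof.
exists 1%N, (fun=> (1 : R)) => x; exists (fun=> (x : R)); rewrite big_ord1.
by rewrite -[RHS]/((1 : R) * (x : R)) mul1r.
Qed.

Fact greg_proj : graded_projective greg.
Proof.
move=> M N g f [lg hg] sg [lf hf].
have [x ex] := sg (f (1 : R)).
have [s [v [us hv xs]]] := homogeneous_decomp (gm_gr M) x.
pose m := if 0 \in s then v 0 else 0.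
have Mm : gm_gr M 0 m.
  by rewrite /m; case: ifP => // _; apply: grading0 (gcompP (gm_gr M)) 0.
have gm : g m = f (1 : R).
  have hgv a : gm_gr N a (g (v a)) by apply: hg.
  rewrite (homogeneous_sum us hgv (hf _ _ (rgrading1 gR))); last first.
    by rewrite -ex xs gm_linear_sum.
  by rewrite /m; case: ifP => // _; rewrite (gm_linear0 lg).
exists (fun r : R => (r : R^c) *: m); split; first split.
- move=> a r t; rewrite scalerA -scalerDl; congr (_ *: _).
- by move=> a r Gr; rewrite -[a]add0r; apply: gm_act.
- move=> r; rewrite (gm_linearZ lg) gm -(gm_linearZ lf); congr f.
  by rewrite -[LHS]/((1 : R) * (r : R)) mul1r.
Qed.

Definition gproj_reg : gproj := GProj greg_fg greg_proj.

Lemma dsum_iso P P' Q Q' :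
  gmod_iso P P' -> gmod_iso Q Q' -> gmod_iso (dsum P Q) (dsum P' Q').
Proof.
move=> [f [lf [f' fK f'K] hf]] [g [lg [g' gK g'K] hg]].
exists (fun x => (f x.1, g x.2)); split.
- by move=> a x y; rewrite /= lf lg.
- by exists (fun x => (f' x.1, g' x.2)) => -[x y] /=; rewrite ?fK ?gK ?f'K ?g'K.
- by move=> a [x y]; split=> -[/hf ? /hg ?].
Qed.

Lemma shift_iso al P P' : gmod_iso P P' -> gmod_iso (gmod_shift al P) (gmod_shift al P').
Proof. by move=> [f [lf bf hf]]; exists f; split=> // a x; apply: hf. Qed.

Lemma dsumA P Q N : gmod_iso (dsum P (dsum Q N)) (dsum (dsum P Q) N).
Proof.
exists (fun x => ((x.1, x.2.1), x.2.2)); split=> //.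
- by exists (fun x => (x.1.1, (x.1.2, x.2))) => [[x [y z]]|[[x y] z]].
- by move=> a [x [y z]]; split=> [[[? ?] ?]|[? [? ?]]].
Qed.

Lemma dsumC P Q : gmod_iso (dsum P Q) (dsum Q P).
Proof.
exists (fun x => (x.2, x.1)); split=> //; first by exists (fun x => (x.2, x.1)); case.
by move=> a [x y]; split=> -[].
Qed.

Lemma dsum0 P : gmod_iso (dsum gmod0 P) P.
Proof.
exists snd; split=> //.
- exists (fun x => (0, x)) => // -[x y] /=; congr pair; apply/rowP; by case.
- by move=> a [x y]; split=> [|[]].
Qed.

Lemma shift_sum al P Q : gmod_iso (gmod_shift al (dsum P Q)) (dsum (gmod_shift al P) (gmod_shift al Q)).
Proof. by exists id; split=> //; exists id. Qed.

Lemma shift_gmod0 al : gmod_iso (gmod_shift al gmod0) gmod0.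
Proof. by exists id; split=> //; exists id. Qed.

Lemma shift0 P : gmod_iso (gmod_shift 0 P) P.
Proof. by exists id; split=> // [|a x]; [exists id|rewrite /= /shift_comp add0r]. Qed.

Lemma shiftD al be P : gmod_iso (gmod_shift (al + be) P) (gmod_shift al (gmod_shift be P)).
Proof.
exists id; split=> // [|a x]; first by exists id.
by rewrite /= /shift_comp /= /shift_comp addrCA addrA.
Qed.

End GradedModules.

(* Isomorphism classes of modules live in a universe strictly above the one of
   the carriers of the algebraic structures of the library, so that the monoid
   of classes and its group completion cannot be given library structures; the
   structures needed are therefore introduced here. *)

Record equiv (T : Type) := Equiv {
  equiv_rel :> T -> T -> Prop;
  equiv_refl : forall x, equiv_rel x x;
  equiv_sym : forall x y, equiv_rel x y -> equiv_rel y x;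
  equiv_trans : forall x y z, equiv_rel x y -> equiv_rel y z -> equiv_rel x z }.

Record quot (T : Type) (E : equiv T) := Quotient {
  qset : T -> Prop;
  qsetP : exists x, qset = E x }.

Section Quotient.
Variables (T : Type) (E : equiv T).
Implicit Types (x y : T) (u : quot E).

Definition qclass x : quot E := Quotient (ex_intro _ x (erefl (equiv_rel E x))).
Definition qrepr u : T := projT1 (cid (qsetP u)).

Lemma quot_inj u v : qset u = qset v -> u = v.
Proof.
case: u v => [A hA] [B hB] /= e; case: B / e hB => hB.
by congr Quotient; apply: Prop_irrelevance.
Qed.

Lemma qclass_eq x y : qclass x = qclass y <-> E x y.
Proof.
split=> [/(congr1 (fun u => qset u y)) /= ->|Exy]; first exact: equiv_refl.
apply: quot_inj; apply: funext => z; apply: propext.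
by split; apply: equiv_trans => //; apply: equiv_sym.
Qed.

Lemma qreprK u : qclass (qrepr u) = u.
Proof. by apply: quot_inj; rewrite /= -(projT2 (cid (qsetP u))). Qed.

Lemma qreprE x : E (qrepr (qclass x)) x.
Proof. by apply/qclass_eq; rewrite qreprK. Qed.

Lemma quotP u : exists x, u = qclass x.
Proof. by exists (qrepr u); rewrite qreprK. Qed.

End Quotient.

(* Commutative monoids with an action of [Gam] by monoid automorphisms. *)
Record gmonoid (Gam : zmodType) := GMonoid {
  gmon_sort :> Type;
  madd : gmon_sort -> gmon_sort -> gmon_sort;
  mzero : gmon_sort;
  mact : Gam -> gmon_sort -> gmon_sort;
  maddA : associative madd;
  maddC : commutative madd;
  madd0 : left_id mzero madd;
  mactD : forall a, {morph mact a : x y / madd x y};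
  mact_zero : forall a, mact a mzero = mzero;
  mact0 : forall x, mact 0 x = x;
  mactA : forall a b x, mact (a + b) x = mact a (mact b x) }.

(* Abelian groups with an additive action of [Gam], that is, Z[Gam]-modules; the
   action of the whole group ring is [zg_scale] below. *)
Record zgmodule (Gam : zmodType) := ZGModule {
  zg_sort :> Type;
  zadd : zg_sort -> zg_sort -> zg_sort;
  zzero : zg_sort;
  zopp : zg_sort -> zg_sort;
  zact : Gam -> zg_sort -> zg_sort;
  zaddA : associative zadd;
  zaddC : commutative zadd;
  zadd0 : left_id zzero zadd;
  zaddN : left_inverse zzero zopp zadd;
  zactD : forall a, {morph zact a : x y / zadd x y};
  zact0 : forall x, zact 0 x = x;
  zactA : forall a b x, zact (a + b) x = zact a (zact b x) }.

Section GroupRing.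
Variables (Gam : zmodType) (K : zgmodule Gam).

Definition zg_mulrn (x : K) (n : nat) : K := iter n (zadd x) (zzero K).

Definition zg_mulrz (x : K) (m : int) : K :=
  match m with
  | Posz n => zg_mulrn x n
  | Negz n => zopp (zg_mulrn x n.+1)
  end.

(* An element c of Z[Gam] is a finitely supported function Gam -> Z, standing for
   the sum of the c(a) a; it sends x to the sum of the c(a) (a x). *)
Definition zg_scale (c : {fsfun Gam -> int with 0}) (x : K) : K :=
  foldr (fun a y => zadd (zg_mulrz (zact a x) (c a)) y) (zzero K) (finsupp c).

End GroupRing.

Definition zg_linear (Gam : zmodType) (K L : zgmodule Gam) (f : K -> L) : Prop :=
  {morph f : x y / zadd x y >-> zadd x y} /\
  forall (c : {fsfun Gam -> int with 0}) (x : K), f (zg_scale c x) = zg_scale c (f x).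

Section GroupCompletion.
Variables (Gam : zmodType) (M : gmonoid Gam).
Local Notation "x ++ y" := (@madd Gam M x y).
Local Notation "0" := (mzero M).
Implicit Types x y z : (M * M)%type.

(* The pair (p, q) stands for the formal difference p - q. *)
Definition gc_rel x y : Prop := exists k : M, x.1 ++ y.2 ++ k = y.1 ++ x.2 ++ k.

Lemma maddAC (a b c : M) : a ++ b ++ c = b ++ a ++ c.
Proof. by rewrite !maddA (maddC a b). Qed.

Lemma maddACA (a b c d : M) : (a ++ b) ++ (c ++ d) = (a ++ c) ++ (b ++ d).
Proof. by rewrite -!maddA (maddAC b c). Qed.

Lemma madd0r (a : M) : a ++ 0 = a. Proof. by rewrite maddC madd0. Qed.

Fact gc_refl x : gc_rel x x. Proof. by exists 0. Qed.

Fact gc_sym x y : gc_rel x y -> gc_rel y x.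
Proof. by case=> k h; exists k. Qed.

Fact gc_trans x y z : gc_rel x y -> gc_rel y z -> gc_rel x z.
Proof.
case=> k h1 [m h2]; exists (y.1 ++ y.2 ++ k ++ m).
have -> : x.1 ++ z.2 ++ y.1 ++ y.2 ++ k ++ m = (x.1 ++ y.2 ++ k) ++ (y.1 ++ z.2 ++ m).
  rewrite -!maddA; congr (_ ++ _).
  rewrite (maddAC z.2 y.1) (maddAC z.2 y.2) (maddAC y.1 y.2); congr (_ ++ _).
  by rewrite (maddAC z.2 k) (maddAC y.1 k).
have -> : z.1 ++ x.2 ++ y.1 ++ y.2 ++ k ++ m = (y.1 ++ x.2 ++ k) ++ (z.1 ++ y.2 ++ m).
  rewrite -!maddA (maddAC z.1 x.2) (maddAC y.1 x.2); congr (_ ++ _).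
  rewrite (maddAC z.1 y.1); congr (_ ++ _).
  by rewrite (maddAC y.2 k) (maddAC z.1 k).
by rewrite h1 h2.
Qed.

Definition gc_equiv : equiv (M * M) := Equiv gc_refl gc_sym gc_trans.
Definition gc := quot gc_equiv.

Definition gc_add (u v : gc) : gc :=
  qclass gc_equiv ((qrepr u).1 ++ (qrepr v).1, (qrepr u).2 ++ (qrepr v).2).
Definition gc_zero : gc := qclass gc_equiv (0, 0).
Definition gc_opp (u : gc) : gc := qclass gc_equiv ((qrepr u).2, (qrepr u).1).
Definition gc_act (a : Gam) (u : gc) : gc :=
  qclass gc_equiv (mact a (qrepr u).1, mact a (qrepr u).2).
Definition gc_in (p : M) : gc := qclass gc_equiv (p, 0).

Lemma gc_addE x y :
  gc_add (qclass _ x) (qclass _ y) = qclass _ (x.1 ++ y.1, x.2 ++ y.2).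
Proof.
apply/qclass_eq; have [k h1] := qreprE gc_equiv x; have [m h2] := qreprE gc_equiv y.
have sh a b c d : (a ++ b) ++ ((c ++ d) ++ (k ++ m)) = (a ++ c ++ k) ++ (b ++ d ++ m).
  by rewrite (maddACA c d) (maddACA a b).
by exists (k ++ m); rewrite /= !sh h1 h2.
Qed.

Lemma gc_oppE x : gc_opp (qclass _ x) = qclass _ (x.2, x.1).
Proof.
apply/qclass_eq; have [k h] := qreprE gc_equiv x; exists k => /=.
by rewrite !maddA (maddC _ x.1) (maddC x.2) -!maddA.
Qed.

Lemma gc_actE a x : gc_act a (qclass _ x) = qclass _ (mact a x.1, mact a x.2).
Proof.
apply/qclass_eq; have [k h] := qreprE gc_equiv x; exists (mact a k) => /=.
by rewrite -!mactD h.
Qed.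

Fact gc_addA : associative gc_add.
Proof.
move=> u v w; have [x ->] := quotP u; have [y ->] := quotP v.
by have [z ->] := quotP w; rewrite !gc_addE /= !maddA.
Qed.

Fact gc_addC : commutative gc_add.
Proof.
move=> u v; have [x ->] := quotP u; have [y ->] := quotP v.
by rewrite !gc_addE maddC (maddC x.2).
Qed.

Fact gc_add0 : left_id gc_zero gc_add.
Proof. by move=> u; have [[x y] ->] := quotP u; rewrite gc_addE /= !madd0. Qed.

Fact gc_addN : left_inverse gc_zero gc_opp gc_add.
Proof.
move=> u; have [x ->] := quotP u; rewrite gc_oppE gc_addE.
by apply/qclass_eq; exists 0; rewrite /= !madd0r madd0 maddC.
Qed.

Fact gc_actD a : {morph gc_act a : u v / gc_add u v}.
Proof.
move=> u v; have [x ->] := quotP u; have [y ->] := quotP v.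
by rewrite !(gc_addE, gc_actE) /= !mactD.
Qed.

Fact gc_act0 u : gc_act 0%R u = u.
Proof. by have [[x y] ->] := quotP u; rewrite gc_actE /= !mact0. Qed.

Fact gc_actA a b u : gc_act (a + b)%R u = gc_act a (gc_act b u).
Proof. by have [x ->] := quotP u; rewrite !gc_actE /= !mactA. Qed.

Definition group_completion : zgmodule Gam :=
  ZGModule gc_addA gc_addC gc_add0 gc_addN gc_actD gc_act0 gc_actA.

End GroupCompletion.

Section GradedK0.
Variables (Gam : zmodType) (R : pzRingType) (gR : ring_grading Gam R).
Local Notation gproj := (gproj gR).

Definition gproj_iso : equiv gproj :=
  @Equiv gproj (fun P Q => gmod_iso P Q) (fun P => gmod_iso_refl P)
    (fun P Q => @gmod_iso_sym _ _ _ P Q) (fun P Q N => @gmod_iso_trans _ _ _ P Q N).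

Definition vgr_sort := quot gproj_iso.
Implicit Types u v w : vgr_sort.

Definition vgr_add u v : vgr_sort := qclass _ (gproj_sum (qrepr u) (qrepr v)).
Definition vgr_zero : vgr_sort := qclass gproj_iso (gproj0 gR).
Definition vgr_act (a : Gam) u : vgr_sort := qclass _ (gproj_shift a (qrepr u)).

Lemma vgr_addE P Q :
  vgr_add (qclass _ P) (qclass _ Q) = qclass gproj_iso (gproj_sum P Q).
Proof.
by apply/qclass_eq; apply: dsum_iso; [apply: (qreprE gproj_iso P)|apply: (qreprE gproj_iso Q)].
Qed.

Lemma vgr_actE a P : vgr_act a (qclass _ P) = qclass gproj_iso (gproj_shift a P).
Proof. by apply/qclass_eq; apply: shift_iso; apply: (qreprE gproj_iso P). Qed.

Fact vgr_addA : associative vgr_add.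
Proof.
move=> u v w; have [P ->] := quotP u; have [Q ->] := quotP v.
by have [N ->] := quotP w; rewrite !vgr_addE; apply/qclass_eq; apply: dsumA.
Qed.

Fact vgr_addC : commutative vgr_add.
Proof.
move=> u v; have [P ->] := quotP u; have [Q ->] := quotP v.
by rewrite !vgr_addE; apply/qclass_eq; apply: dsumC.
Qed.

Fact vgr_add0 : left_id vgr_zero vgr_add.
Proof.
by move=> u; have [P ->] := quotP u; rewrite vgr_addE; apply/qclass_eq; apply: dsum0.
Qed.

Fact vgr_actD a : {morph vgr_act a : u v / vgr_add u v}.
Proof.
move=> u v; have [P ->] := quotP u; have [Q ->] := quotP v.
by rewrite !(vgr_addE, vgr_actE); apply/qclass_eq; apply: shift_sum.
Qed.

Fact vgr_act_zero a : vgr_act a vgr_zero = vgr_zero.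
Proof. by rewrite vgr_actE; apply/qclass_eq; apply: shift_gmod0. Qed.

Fact vgr_act0 u : vgr_act 0 u = u.
Proof. by have [P ->] := quotP u; rewrite vgr_actE; apply/qclass_eq; apply: shift0. Qed.

Fact vgr_actA a b u : vgr_act (a + b) u = vgr_act a (vgr_act b u).
Proof.
by have [P ->] := quotP u; rewrite !vgr_actE; apply/qclass_eq; apply: shiftD.
Qed.

Definition vgr : gmonoid Gam :=
  GMonoid vgr_addA vgr_addC vgr_add0 vgr_actD vgr_act_zero vgr_act0 vgr_actA.

Definition K0gr : zgmodule Gam := group_completion vgr.

Definition K0gr_class (P : gproj) : K0gr := gc_in (qclass gproj_iso P : vgr).

Definition K0gr_pos (x : K0gr) : Prop := exists P : gproj, x = K0gr_class P.

Definition K0gr_unit : K0gr := K0gr_class (gproj_reg gR).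

End GradedK0.

Definition K0gr_ordered_iso (Gam : zmodType) (R S : pzRingType)
    (gR : ring_grading Gam R) (gS : ring_grading Gam S) : Prop :=
  exists f : K0gr gR -> K0gr gS,
    [/\ bijective f,
        zg_linear f,
        forall y, K0gr_pos y <-> exists2 x, K0gr_pos x & f x = y
      & f (K0gr_unit gR) = K0gr_unit gS].

(* Main.v *)
Require Import Defs.
From HB Require Import structures.
From mathcomp Require Import all_boot all_algebra.
From mathcomp Require Import finmap.
From mathcomp Require Import boolp classical_sets.

Set Implicit Arguments.
Unset Strict Implicit.
Unset Printing Implicit Defensive.
Import GRing.Theory.
Local Open Scope ring_scope.

(* Elliott's intertwining argument.  A graded matricial algebra is handled
   through its homogeneous matrix units.  Over a graded field, Gaussian
   elimination shows that the degree-0 part of a graded matricial algebra is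
   unit-regular, and this passes to the graded matrix rings over the union R.
   Hence graded finitely generated projective modules cancel, so that equality
   of classes in K_0^gr is isomorphism.  Therefore an ordered isomorphism phi
   lifts every family of matrix units of R to one of S with classes given by
   phi, and two families with the same classes are conjugate by a unit of degree
   0.  These two facts extend a partial homomorphism alternately to larger
   subalgebras of R and of S; the union of the graphs is the graph of a graded
   isomorphism.  The converse is restriction of scalars. *)

(** * Diagonal reduction along a family of orthogonal idempotents *)

(** The obstacle is uniqueness. Classes determine a family of matrix units only up to conjugation,
    so a lift from a larger subalgebra need not extend the homomorphism already built; each step
    corrects the new lift by an inner automorphism before the graphs are compared. The classes are
    taken over R and S, not over the matricial stages, so cancellation has to hold for R and S
    themselves. Projective modules are summands of sums of shifts R(eps i), which is why regularity
    is proved for matrix rings with arbitrary shifts. The corners that serve as pivots carry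
    coefficients of arbitrary degree in A; hence every nonzero homogeneous element of A must be
    invertible, not only those of degree 0. Both properties appear in the limit, since each graph,
    reversed, is contained in the graph of a homomorphism in the opposite direction. *)

Section Pivot.
Variables (T : pzRingType) (I : eqType) (B : T -> Prop) (e : I -> T).
Hypothesis B1 : B 1.
Hypothesis BB : forall x y, B x -> B y -> B (x - y).
Hypothesis BM : forall x y, B x -> B y -> B (x * y).
Hypothesis Be : forall p, B (e p).
Hypothesis ee : forall p, e p * e p = e p.
Hypothesis eo : forall p q, p != q -> e p * e q = 0.
(** This replaces division: a nonzero corner is an isomorphism between two of the idempotents.
    Elements of [B] then behave like matrices indexed by [I] in which every nonzero entry can serve
    as a pivot. *)
Hypothesis e_div : forall p q z, B z -> e p * z * e q = z -> z != 0 ->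
  exists y, [/\ B y, e q * y * e p = y, z * y = e p & y * z = e q].

Let B0 : B 0. Proof. by rewrite -(subrr 1); apply: BB. Qed.
Let BN x : B x -> B (- x). Proof. by rewrite -sub0r; apply: BB. Qed.
Let BD x y : B x -> B y -> B (x + y).
Proof. by move=> Bx By; rewrite -[y]opprK; apply: BB => //; apply: BN. Qed.

Local Notation Es s := (\sum_(p <- s) e p).

Let BE (s : seq I) : B (Es s).
Proof. by elim: s => [|p s IH]; rewrite ?big_nil // big_cons; apply: BD. Qed.

(** Fixing the [e q] for [q] outside [s] on both sides ensures that the units found by induction on
    the remaining indices leave a cleared pivot untouched. *)
Definition unit_on (s : seq I) (w : T) := exists wi : T,
  [/\ B w, B wi, w * wi = 1, wi * w = 1 &
      forall q, q \notin s -> w * e q = e q /\ e q * w = e q].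

Lemma unit_on1 s : unit_on s 1.
Proof. by exists 1; split=> //; rewrite ?mulr1 // => q _; rewrite mulr1 mul1r. Qed.

Lemma unit_onM s w v : unit_on s w -> unit_on s v -> unit_on s (w * v).
Proof.
move=> [wi [Bw Bwi wK Kw we]] [vi [Bv Bvi vK Kv ve]]; exists (vi * wi); split.
- exact: BM.
- exact: BM.
- by rewrite -mulrA (mulrA v) vK mul1r.
- by rewrite -mulrA (mulrA wi) Kw mul1r.
- move=> q qs; have [w1 w2] := we _ qs; have [v1 v2] := ve _ qs.
  by rewrite -mulrA v1 w1 mulrA w2 v2.
Qed.

Lemma unit_onS s s' w : {subset s <= s'} -> unit_on s w -> unit_on s' w.
Proof.
move=> ss [wi [Bw Bwi wK Kw we]]; exists wi; split=> // q qs.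
by apply: we; apply: contra qs; apply: ss.
Qed.

(** Row and column operations: [w] and [v] are independent, so this is equivalence of matrices and
    not conjugacy. *)
Definition mequiv (s : seq I) (a b : T) := exists w v,
  [/\ unit_on s w, unit_on s v & w * a * v = b].

Lemma mequiv_trans s a b c : mequiv s a b -> mequiv s b c -> mequiv s a c.
Proof.
move=> [w [v [uw uv <-]]] [w' [v' [uw' uv' <-]]]; exists (w' * w), (v * v').
by split; [apply: unit_onM|apply: unit_onM|rewrite !mulrA].
Qed.

Lemma mequivS s s' a b : {subset s <= s'} -> mequiv s a b -> mequiv s' a b.
Proof.
by move=> ss [w [v [uw uv e_]]]; exists w, v; split=> //; apply: unit_onS ss _.
Qed.

Lemma sum_mul_notin s q : q \notin s -> (Es s) * e q = 0.
Proof.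
move=> qs; rewrite mulr_suml big1_seq // => p /andP[_ ps]; apply: eo.
by apply: contraNneq qs => <-.
Qed.

Lemma mul_sum_notin s q : q \notin s -> e q * (Es s) = 0.
Proof.
move=> qs; rewrite mulr_sumr big1_seq // => p /andP[_ ps]; apply: eo.
by apply: contraNneq qs => ->.
Qed.

Lemma sum_mul_in s q : uniq s -> q \in s -> (Es s) * e q = e q.
Proof.
move=> us qs; rewrite (bigD1_seq q) //= mulrDl ee mulr_suml big1 ?addr0 // => p.
by apply: eo.
Qed.

Lemma mul_sum_in s q : uniq s -> q \in s -> e q * (Es s) = e q.
Proof.
move=> us qs; rewrite (bigD1_seq q) //= mulrDr ee mulr_sumr big1 ?addr0 // => p pq.
by apply: eo; rewrite eq_sym.
Qed.

Lemma sum_idem s : uniq s -> (Es s) * (Es s) = (Es s).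
Proof.
move=> us; rewrite mulr_sumr; apply: eq_big_seq => q qs; exact: sum_mul_in.
Qed.

Lemma unit_on_square0 s n : B n -> n * n = 0 ->
  (forall q, q \notin s -> n * e q = 0 /\ e q * n = 0) -> unit_on s (1 - n).
Proof.
move=> Bn nn ne; exists (1 + n); split; [exact: BB|exact: BD| | |].
- by rewrite mulrBl mul1r mulrDr mulr1 nn addr0 addrK.
- by rewrite mulrBr mulr1 mulrDl mul1r nn addr0 addrK.
- by move=> q /ne[n1 n2]; rewrite mulrBl mulrBr n1 n2 mul1r mulr1 subr0.
Qed.

(** A transposition of [p] and [q], twisted by the mutually inverse [c] and [y]. It is an
    involution, hence its own inverse. *)
Lemma unit_on_swap s p q c y : uniq s -> p \in s -> q \in s -> p != q ->
  B c -> B y -> e p * c * e q = c -> e q * y * e p = y ->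
  c * y = e p -> y * c = e q -> unit_on s (1 - e p - e q + (c + y)).
Proof.
move=> us ps qs pq Bc By pcq qyp cy yc.
have qp : q != p by rewrite eq_sym.
have c2 : c * c = 0 by rewrite -pcq -!mulrA (mulrA (e q) (e p)) eo // mul0r !mulr0.
have y2 : y * y = 0 by rewrite -qyp -!mulrA (mulrA (e p) (e q)) eo // mul0r !mulr0.
have epc : e p * c = c by rewrite -pcq !mulrA ee.
have eqc : e q * c = 0 by rewrite -pcq !mulrA eo // !mul0r.
have ceq : c * e q = c by rewrite -pcq -!mulrA ee.
have cep : c * e p = 0 by rewrite -pcq -!mulrA eo // !mulr0.
have eqy : e q * y = y by rewrite -qyp !mulrA ee.
have epy : e p * y = 0 by rewrite -qyp !mulrA eo // !mul0r.
have yep : y * e p = y by rewrite -qyp -!mulrA ee.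
have yeq : y * e q = 0 by rewrite -qyp -!mulrA eo // !mulr0.
have sq : (1 - e p - e q + (c + y)) * (1 - e p - e q + (c + y)) = 1.
  set g := 1 - e p - e q; set z := c + y.
  have gp : g * e p = 0 by rewrite !mulrBl mul1r ee (eo qp) subrr subr0.
  have gq : g * e q = 0 by rewrite !mulrBl mul1r ee (eo pq) subr0 subrr.
  have gg : g * g = g by rewrite {2}/g !mulrBr mulr1 gp gq !subr0.
  have gz : g * z = 0 by rewrite mulrDr !mulrBl !mul1r epc eqc epy eqy !(subr0, subrr) addr0.
  have zg : z * g = 0.
    by rewrite mulrDl !mulrBr !mulr1 cep ceq yep yeq !(subr0, subrr) addr0.
  have zz : z * z = e p + e q.
    by rewrite mulrDl !mulrDr c2 y2 cy yc add0r addr0.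
  by rewrite (mulrDl g z) (mulrDr g g z) (mulrDr z g z) gg gz zg zz addr0 add0r /g -(addrA 1) -opprD subrK.
exists (1 - e p - e q + (c + y)); split=> //.
- by apply: BD; [apply: BB => //; apply: BB|apply: BD].
- by apply: BD; [apply: BB => //; apply: BB|apply: BD].
- move=> r rs.
  have pr : p != r by apply: contraNneq rs => <-.
  have qr : q != r by apply: contraNneq rs => <-.
  have rp : r != p by rewrite eq_sym.
  have rq : r != q by rewrite eq_sym.
  have cr : c * e r = 0 by rewrite -pcq -!mulrA eo // !mulr0.
  have rc : e r * c = 0 by rewrite -pcq !mulrA eo // !mul0r.
  have yr : y * e r = 0 by rewrite -qyp -!mulrA eo // !mulr0.
  have ry : e r * y = 0 by rewrite -qyp !mulrA eo // !mul0r.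
  rewrite mulrDl mulrDr !mulrBl !mulrBr !(mulrDl, mulrDr) mul1r mulr1 (eo pr) (eo qr).
  by rewrite (eo rp) (eo rq) cr rc yr ry !subr0 !addr0.
Qed.

(* Clears the rest of the row and of the column of the pivot [e p * a * e p]. *)
Lemma mequiv_pivot s p a : uniq (p :: s) -> B a ->
  Es (p :: s) * a * Es (p :: s) = a -> e p * a * e p != 0 ->
  exists a', [/\ B a', Es s * a' * Es s = a' & mequiv (p :: s) a (e p + a')].
Proof.
move=> ups Ba aE nz; have /= /andP[ps us] := ups.
have [y [By ype cy yc]] : exists y, [/\ B y, e p * y * e p = y,
    e p * a * e p * y = e p & y * (e p * a * e p) = e p].
  by apply: e_div => //; [apply: BM => //; apply: BM|rewrite !mulrA ee -!mulrA ee].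
set E := Es s.
have Ep : E * e p = 0 by apply: sum_mul_notin.
have pE : e p * E = 0 by apply: mul_sum_notin.
have EE : E * E = E by apply: sum_idem.
have BEs : B E by apply: BE.
have py : e p * y = y by rewrite -ype !mulrA ee.
have yp : y * e p = y by rewrite -ype -!mulrA ee.
have Ey : E * y = 0 by rewrite -py mulrA Ep mul0r.
have yE : y * E = 0 by rewrite -yp -mulrA pE mulr0.
have eE : Es (p :: s) = e p + E by rewrite big_cons.
rewrite eE in aE.
have al : e p * a + E * a = a.
  by rewrite -{3}aE -mulrDl -[in LHS]aE !mulrA mulrDl !mulrDr ee Ep pE EE addr0 add0r.
have ar : a * e p + a * E = a.
  by rewrite -{3}aE -mulrDr -[in LHS]aE -!mulrA mulrDr !mulrDl ee Ep pE EE addr0 add0r.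
have yap : y * a * e p = e p by rewrite -{1}yp -!mulrA (mulrA (e p)) yc.
have pay : e p * a * y = e p by rewrite -{1}py !mulrA cy.
have ni q : q \notin p :: s -> [/\ p != q, E * e q = 0 & e q * E = 0].
  rewrite inE negb_or eq_sym => /andP[? ?].
  by split=> //; [apply: sum_mul_notin|apply: mul_sum_notin].
have yq q : q \notin p :: s -> y * e q = 0 /\ e q * y = 0.
  case/ni=> pq _ _; split; first by rewrite -yp -mulrA eo // mulr0.
  by rewrite -py mulrA eo ?mul0r // eq_sym.
(* On the left, [1 - E * a * y] clears the column of [p]; on the right, [1 - y * a * E] clears its
   row. *)
have u1 : unit_on (p :: s) (1 - E * a * y).
  apply: unit_on_square0; first by apply: BM => //; apply: BM.
    by rewrite -!mulrA (mulrA y E) yE mul0r !mulr0.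
  move=> q qs; have [_ _ qE] := ni _ qs; have [y1 y2] := yq _ qs.
  by rewrite -!mulrA y1 !mulr0 !mulrA qE !mul0r.
have u2 : unit_on (p :: s) (1 - y * a * E).
  apply: unit_on_square0; first by apply: BM => //; apply: BM.
    by rewrite -!mulrA (mulrA E y) Ey mul0r !mulr0.
  move=> q qs; have [_ Eq _] := ni _ qs; have [y1 y2] := yq _ qs.
  by rewrite -!mulrA Eq !mulr0 !mulrA y2 !mul0r.
(* This unit normalizes the pivot to [e p]; in its inverse, [y] is replaced by the pivot itself. *)
have u3 : unit_on (p :: s) (1 - e p + y).
  have gD x : e p * x = x -> (1 - e p) * (1 - e p + x) = 1 - e p.
    by move=> px; rewrite mulrDr mulrBr mulr1 mulrBl mul1r ee subrr subr0 mulrBl mul1r px subrr addr0.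
  have pc : e p * (e p * a * e p) = e p * a * e p by rewrite !mulrA ee.
  have cp : e p * a * e p * e p = e p * a * e p by rewrite -!mulrA ee.
  exists (1 - e p + e p * a * e p); split.
  - by apply: BD => //; apply: BB.
  - by apply: BD; [apply: BB|apply: BM => //; apply: BM].
  - by rewrite mulrDl gD ?pc // mulrDr mulrBr mulr1 yp subrr add0r yc subrK.
  - by rewrite mulrDl gD ?py // mulrDr mulrBr mulr1 cp subrr add0r cy subrK.
  - move=> q qs; have [y1 y2] := yq _ qs; have [pq _ _] := ni _ qs.
    rewrite mulrDl mulrDr mulrBl mulrBr mul1r mulr1 y1 y2 !eo //; last by rewrite eq_sym.
    by rewrite !subr0 !addr0.
pose b := (1 - E * a * y) * a * (1 - y * a * E).
have pb : e p * b = e p * a * e p.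
  have pw : e p * (1 - E * a * y) = e p by rewrite mulrBr mulr1 !mulrA pE !mul0r subr0.
  by rewrite /b !mulrA pw mulrBr mulr1 !mulrA pay -{1}ar mulrDr !mulrA addrK.
have bp : b * e p = e p * a * e p.
  have wp : (1 - y * a * E) * e p = e p by rewrite mulrBl mul1r -!mulrA Ep !mulr0 subr0.
  rewrite /b -(mulrA _ (1 - y * a * E)) wp -mulrA mulrBl mul1r -!mulrA (mulrA y) yap.
  by rewrite -{1}al mulrDl -!mulrA addrK.
have bE : b = e p * a * e p + E * b * E.
  have Pb : (e p + E) * b = b.
    rewrite /b (mulrA (e p + E)); congr (_ * _).
    by rewrite mulrBl mul1r mulrBr mulrDl al !mulrA (mulrDl (e p)) pE EE add0r.
  have bP : b * (e p + E) = b.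
    rewrite /b -(mulrA _ (1 - y * a * E)) -!(mulrA _ a); congr (_ * _).
    by rewrite mulrBl mul1r !(mulrBr a) mulr1 (mulrDr a) ar -!mulrA (mulrDr E) Ep EE add0r.
  rewrite -[LHS]bP -[in LHS]Pb !mulrDr !mulrDl pb -(mulrA _ (e p) E) pE mulr0.
  by rewrite -(mulrA _ (e p) (e p)) ee -(mulrA E b (e p)) bp !(mulrA E) Ep !mul0r addr0 add0r.
exists (E * b * E); split.
- by do !apply: BM => //; apply: BB => //; do !apply: BM.
- by rewrite !mulrA EE -!mulrA EE.
- exists ((1 - e p + y) * (1 - E * a * y)), (1 - y * a * E); split=> //.
    exact: unit_onM.
  have -> : (1 - e p + y) * (1 - E * a * y) * a * (1 - y * a * E) = (1 - e p + y) * b.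
    by rewrite /b !mulrA.
  rewrite {1}bE mulrDr; congr (_ + _).
    by rewrite mulrDl mulrBl mul1r !mulrA ee subrr add0r -!mulrA (mulrA (e p)) yc.
  by rewrite mulrDl mulrBl mul1r !mulrA yE pE !mul0r subr0 addr0.
Qed.

(** Induction on the indices. If the diagonal corner at [p] vanishes, a nonzero corner in the row or
    column of [p] is moved there by a swap. If there is none, the row and the column are zero and
    [p] is dropped, so [t] may be smaller than [s]. *)
Lemma mequiv_diag s a : uniq s -> B a -> Es s * a * Es s = a ->
  exists t, [/\ uniq t, {subset t <= s} & mequiv s a (Es t)].
Proof.
elim: s a => [|p s IH] a us Ba aE.
  exists [::]; split=> [//|q //|]; exists 1, 1; split; try exact: unit_on1.
  by rewrite -aE !big_nil !mulr0 mul0r.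
have sub : {subset s <= p :: s} by move=> q qs; rewrite inE qs orbT.
have /= /andP[ps us'] := us.
have main b : B b -> Es (p :: s) * b * Es (p :: s) = b -> e p * b * e p != 0 ->
    exists t, [/\ uniq t, {subset t <= p :: s} & mequiv (p :: s) b (Es t)].
  move=> Bb bE nz; have [a' [Ba' a'E ba']] := mequiv_pivot us Bb bE nz.
  have [t [ut ts [w [v [uw uv wav]]]]] := IH a' us' Ba' a'E.
  exists (p :: t); split.
  - by rewrite /= ut andbT; apply: contra ps; apply: ts.
  - move=> q; rewrite !inE => /orP[->//|/ts ->]; exact: orbT.
  - apply: mequiv_trans ba' _; exists w, v; split; [exact: unit_onS uw|exact: unit_onS uv|].
    rewrite big_cons mulrDr mulrDl wav; congr (_ + _).
    have [_ [_ _ _ _ /(_ _ ps)[wp _]]] := uw; have [_ [_ _ _ _ /(_ _ ps)[_ pv]]] := uv.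
    by rewrite wp pv.
have step b : B b -> Es (p :: s) * b * Es (p :: s) = b -> mequiv (p :: s) a b ->
    e p * b * e p != 0 ->
    exists t, [/\ uniq t, {subset t <= p :: s} & mequiv (p :: s) a (Es t)].
  move=> Bb bE ab nz; have [t [ut ts bt]] := main b Bb bE nz.
  by exists t; split=> //; apply: mequiv_trans bt.
have [nz|z00] := boolP (e p * a * e p != 0); first exact: main.
move: z00; rewrite negbK => /eqP z00.
have swapP q : q \in s -> [/\ p != q, q \in p :: s & p \in p :: s].
  by move=> qs; rewrite mem_head sub //; split=> //; apply: contraNneq ps => ->.
have swap_on q : q \in s -> forall c y, B c -> B y -> e p * c * e q = c ->
    e q * y * e p = y -> c * y = e p -> y * c = e q ->
    exists t, [/\ unit_on (p :: s) t, Es (p :: s) * t = t * Es (p :: s),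
      t * e p = y & e p * t = c].
  move=> qs c y Bc By cE yE cy yc; have [pq qin pin] := swapP q qs.
  have qp : q != p by rewrite eq_sym.
  exists (1 - e p - e q + (c + y)); split; first exact: unit_on_swap.
  -   rewrite mulrDr mulrDl !mulrBr !mulrBl mulr1 mul1r !(sum_mul_in us, mul_sum_in us) //.
    congr (_ + _); rewrite mulrDr mulrDl; congr (_ + _).
      by rewrite -cE !mulrA sum_mul_in // -!mulrA mul_sum_in.
    by rewrite -yE !mulrA sum_mul_in // -!mulrA mul_sum_in.
  - rewrite mulrDl !mulrBl mul1r ee (eo qp) subr0 subrr add0r mulrDl.
    by rewrite -cE -!mulrA (eo qp) !mulr0 add0r -yE -!mulrA ee.
  - rewrite mulrDr !mulrBr mulr1 ee (eo pq) subr0 subrr add0r mulrDr.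
    by rewrite -yE !mulrA (eo pq) !mul0r addr0 -cE !mulrA ee.
have [/hasP[q qs nz]|/hasPn rz] := boolP (has (fun q => e p * a * e q != 0) s).
  have [pq qin pin] := swapP q qs.
  have Bc : B (e p * a * e q) by apply: BM => //; apply: BM.
  have cE : e p * (e p * a * e q) * e q = e p * a * e q by rewrite !mulrA ee -!mulrA ee.
  have [y [By yE cy yc]] := e_div Bc cE nz.
  have [t [ut tE tp _]] := swap_on q qs _ _ Bc By cE yE cy yc.
  have [ti [Bt _ _ _ _]] := ut.
  apply: (step (a * t)); first exact: BM.
  - by rewrite -!mulrA -tE !mulrA aE.
  - by exists 1, t; split=> //; [exact: unit_on1|rewrite mul1r].
  - have -> : e p * (a * t) * e p = e p.
      have qy : e q * y = y by rewrite -yE !mulrA ee.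
      by rewrite -!mulrA tp -qy !mulrA cy.
    by apply: contraNneq nz => ->; rewrite !mul0r.
have [/hasP[q qs nz]|/hasPn cz] := boolP (has (fun q => e q * a * e p != 0) s).
  have [pq qin pin] := swapP q qs.
  have Bc : B (e q * a * e p) by apply: BM => //; apply: BM.
  have cE : e q * (e q * a * e p) * e p = e q * a * e p by rewrite !mulrA ee -!mulrA ee.
  have [y [By yE cy yc]] := e_div Bc cE nz.
  have [t [ut tE _ pt]] := swap_on q qs _ _ By Bc yE cE yc cy.
  have [ti [Bt _ _ _ _]] := ut.
  apply: (step (t * a)); first exact: BM.
  - by rewrite !mulrA tE -!mulrA (mulrA _ a) aE.
  - by exists t, 1; split=> //; [exact: unit_on1|rewrite mulr1].
  - have -> : e p * (t * a) * e p = e p.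
      have yq : y * e q = y by rewrite -yE -!mulrA ee.
      by rewrite mulrA pt -yq -!mulrA (mulrA (e q)) yc.
    by apply: contraNneq nz => ->; rewrite !mulr0.
have pa : e p * a = 0.
  rewrite -aE mulrA (mulrA (e p)) mul_sum_in ?mem_head // mulr_sumr big_cons z00 add0r.
  by rewrite big1_seq // => q /andP[_ /rz]; rewrite negbK => /eqP.
have ap : a * e p = 0.
  rewrite -aE -mulrA sum_mul_in ?mem_head // -mulrA mulr_suml big_cons mulrA z00 add0r.
  by rewrite big1_seq // => q /andP[_ /cz]; rewrite negbK mulrA => /eqP.
have aE' : Es s * a * Es s = a.
  by move: aE; rewrite big_cons mulrDl pa add0r mulrDr -(mulrA _ a (e p)) ap mulr0 add0r.
have [t [ut ts at_]] := IH a us' Ba aE'.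
by exists t; split=> // [q /ts/sub //|]; apply: mequivS at_.
Qed.

Lemma idempotent_family_diag s a : uniq s -> Es s = 1 -> B a ->
  exists w wi v vi t, [/\ [/\ B w, B wi, w * wi = 1 & wi * w = 1],
    [/\ B v, B vi, v * vi = 1 & vi * v = 1], uniq t & w * a * v = Es t].
Proof.
move=> us s1 Ba; have [|t [ut _ [w [v [[wi [? ? ? ? _]] [vi [? ? ? ? _]] e_]]]]] := mequiv_diag us Ba.
  by rewrite s1 mul1r mulr1.
by exists w, wi, v, vi, t.
Qed.

(** If [w * a * v] is idempotent, then [u = v * w] works: [a * u * a] is the square of [w * a * v]
    between the inverses of [w] and [v]. *)
Lemma unit_regular s a : uniq s -> Es s = 1 -> B a ->
  exists u ui, [/\ B u, B ui, u * ui = 1, ui * u = 1 & a * u * a = a].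
Proof.
move=> us s1 Ba.
have [w [wi [v [vi [t [[? ? wK Kw] [? ? vK Kv] ut e_]]]]]] := idempotent_family_diag us s1 Ba.
exists (v * w), (wi * vi); split; try exact: BM.
- by rewrite -mulrA (mulrA w) wK mul1r.
- by rewrite -mulrA (mulrA vi) Kv mul1r.
- have aE : a = wi * Es t * vi by rewrite -e_ -!mulrA vK mulr1 mulrA Kw mul1r.
  rewrite [LHS](_ : _ = wi * (w * a * v) * (w * a * v) * vi).
    by rewrite e_ -(mulrA wi) sum_idem // -aE.
  by rewrite -!mulrA vK mulr1 !mulrA Kw mul1r.
Qed.
End Pivot.

(** * Matrix units *)

Lemma gcomp_sum (Gam V : zmodType) (D : grading Gam V) a (I : Type) (s : seq I)
  (P : pred I) (F : I -> V) :
  (forall i, P i -> D a (F i)) -> D a (\sum_(i <- s | P i) F i).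
Proof.
move=> DF; elim/big_ind: _ => //; first exact: grading0 (gcompP D) a.
by move=> x y; apply: gcompD.
Qed.

(** [graded_field] gives an inverse of unspecified degree. Comparing degrees in [x * y = 1] shows
    that its component of degree [- a] is already an inverse. *)
Lemma homogeneous_inv (Gam : zmodType) (A : comNzRingType) (gA : ring_grading Gam A)
  a x : graded_field gA -> gA a x -> x != 0 -> exists2 y, gA (- a) y & x * y = 1.
Proof.
move=> hA Ax /(hA _ _ Ax)[y xy].
have [s [v [us hv yE]]] := homogeneous_decomp gA y.
have h b : gA b (x * v (b - a)) by rewrite -[b in gA b](subrKC a); apply: rgradingM.
have := homogeneous_sum (s := [seq a + b | b <- s]) _ h (rgrading1 gA).
rewrite map_inj_uniq; last exact: addrI.
rewrite us big_map -xy {1}yE mulr_sumr sub0r => /(_ erefl) ->; last first.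
  by apply: eq_bigr => b _; rewrite addrC addKr.
case: ifP => _; first by exists (v (- a)).
by exists 0; [exact: grading0 (gcompP gA) _|rewrite mulr0].
Qed.

Section MatrixUnits.
Variables (Gam : zmodType) (A : comNzRingType) (gA : ring_grading Gam A).
Variables (T : algType A) (D : finType) (rep : D -> D).

(* Matrix units indexed by the disjoint union [D] of the index sets of the
   blocks; [rep] sends an index to a representative of its block. *)
Record mxunits (E : D -> D -> T) : Prop := MxUnits {
  mxunits_off : forall p q, rep p != rep q -> E p q = 0;
  mxunitsM : forall p q s, rep p = rep q -> E p q * E q s = E p s;
  mxunitsM0 : forall p q r s, q != r -> E p q * E r s = 0;
  mxunits1 : \sum_p E p p = 1 }.

(** For matrix units, the coefficients at indices of different blocks are harmless, because [E p q]
    is then zero. *)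
Definition mxcomb (E : D -> D -> T) (c : D -> D -> A) : T :=
  \sum_p \sum_q c p q *: E p q.

Lemma mxcombD E c c' : mxcomb E c + mxcomb E c' = mxcomb E (fun p q => c p q + c' p q).
Proof.
rewrite -big_split; apply: eq_bigr => p _; rewrite -big_split.
by apply: eq_bigr => q _; rewrite scalerDl.
Qed.

Lemma mxcombZ E a c : a *: mxcomb E c = mxcomb E (fun p q => a * c p q).
Proof.
rewrite scaler_sumr; apply: eq_bigr => p _; rewrite scaler_sumr.
by apply: eq_bigr => q _; rewrite scalerA.
Qed.

Definition mxsingle (p q : D) (a : A) : D -> D -> A :=
  fun r s => if (r == p) && (s == q) then a else 0.

Lemma mxcomb_single E p q a : mxcomb E (mxsingle p q a) = a *: E p q.
Proof.
rewrite /mxcomb (bigD1 p) //= (bigD1 q) //= /mxsingle !eqxx /=.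
rewrite !big1 ?addr0 // => [r /negPf rp|s /negPf sq]; last by rewrite sq scale0r.
by rewrite big1 // => s _; rewrite rp scale0r.
Qed.

Variables (E : D -> D -> T) (hE : mxunits E).

Lemma mxunits_idem p : E p p * E p p = E p p.
Proof. exact: mxunitsM. Qed.

Lemma mxunitsMr p q s : rep q = rep s -> E p q * E q s = E p s.
Proof.
move=> qs; have [pq|pq] := eqVneq (rep p) (rep q); first exact: mxunitsM.
by rewrite (mxunits_off hE pq) mul0r (mxunits_off hE) // -qs.
Qed.

Lemma mxcomb_coef c p q : E p p * mxcomb E c * E q q = c p q *: E p q.
Proof.
rewrite mulr_sumr mulr_suml (bigD1 p) //= [X in _ + X]big1 ?addr0; last first.
  move=> r rp; rewrite !(mulr_sumr, mulr_suml) big1 // => s _.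
  by rewrite -scalerAr -scalerAl (mxunitsM0 hE) 1?eq_sym // mul0r scaler0.
rewrite mulr_sumr mulr_suml (bigD1 q) //= [X in _ + X]big1 ?addr0; last first.
  by move=> s sq; rewrite -scalerAr -scalerAl -mulrA (mxunitsM0 hE _ _ sq) mulr0 scaler0.
by rewrite -scalerAr -scalerAl (mxunitsM hE) // mxunitsMr.
Qed.

Variable delta : D -> Gam.

(* The unit [E p q] has degree [delta p - delta q]. *)
Definition hspan a (z : T) : Prop := exists c : D -> D -> A,
  (forall p q, gA (a + delta q - delta p) (c p q)) /\ z = mxcomb E c.

Lemma hspan0 a : hspan a 0.
Proof.
exists (fun _ _ => 0); split=> [p q|]; first exact: grading0 (gcompP gA) _.
by rewrite /mxcomb big1 // => p _; rewrite big1 // => q _; rewrite scale0r.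
Qed.

Lemma hspanD a x y : hspan a x -> hspan a y -> hspan a (x + y).
Proof.
move=> [c [hc ->]] [d [hd ->]]; exists (fun p q => c p q + d p q).
by split=> [p q|]; [exact: gcompD|rewrite mxcombD].
Qed.

Lemma hspanN a x : hspan a x -> hspan a (- x).
Proof.
move=> [c [hc ->]]; exists (fun p q => - c p q); split=> [p q|]; first exact: gcompN.
rewrite -scaleN1r mxcombZ; congr mxcomb.
by apply: funext => p; apply: funext => q; rewrite mulN1r.
Qed.

Lemma hspanB a x y : hspan a x -> hspan a y -> hspan a (x - y).
Proof. by move=> hx hy; apply/hspanD/hspanN. Qed.

Lemma hspan_sum a (I : Type) (s : seq I) (F : I -> T) :
  (forall i, hspan a (F i)) -> hspan a (\sum_(i <- s) F i).
Proof.
by move=> hF; elim/big_ind: _ => //; [exact: hspan0|exact: hspanD].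
Qed.

Lemma hspanZE a p q c : gA (a + delta q - delta p) c -> hspan a (c *: E p q).
Proof.
move=> Ac; exists (mxsingle p q c); rewrite mxcomb_single; split=> // r s.
rewrite /mxsingle; case: ifP => [/andP[/eqP-> /eqP->] //|_].
exact: grading0 (gcompP gA) _.
Qed.

Lemma hspanE p q : hspan (delta p - delta q) (E p q).
Proof.
rewrite -[E p q]scale1r; apply: hspanZE; rewrite addrNK subrr; exact: rgrading1.
Qed.

Lemma hspanE0 p : hspan 0 (E p p).
Proof. by rewrite -(subrr (delta p)); apply: hspanE. Qed.

Lemma hspan1 : hspan 0 1.
Proof. by rewrite -(mxunits1 hE); apply: hspan_sum => p; apply: hspanE0. Qed.

Lemma hspanM a b x y : hspan a x -> hspan b y -> hspan (a + b) (x * y).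
Proof.
move=> [c [hc ->]] [d [hd ->]].
rewrite mulr_suml; apply: hspan_sum => p; rewrite mulr_suml; apply: hspan_sum => q.
rewrite mulr_sumr; apply: hspan_sum => r; rewrite mulr_sumr; apply: hspan_sum => s.
rewrite -scalerAl -scalerAr scalerA.
have [->|qr] := eqVneq q r; last by rewrite (mxunitsM0 hE) // scaler0; exact: hspan0.
have [pr|pr] := eqVneq (rep p) (rep r); last first.
  by rewrite (mxunits_off hE pr) mul0r scaler0; exact: hspan0.
rewrite (mxunitsM hE) //; apply: hspanZE.
have := rgradingM (hc p r) (hd r s).
congr (gA _ _); rewrite addrACA (addrACA a) -!addrA; congr (_ + (_ + _)).
by rewrite (addrA (delta s)) addrCA subrr addr0.
Qed.

(** A corner is a single homogeneous coefficient times [E p q], and the graded field inverts it. The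
    degree [a] is arbitrary because entries of a shifted matrix ring have any degree. *)
Lemma hspan_div (hA : graded_field gA) a p q z :
  hspan a z -> E p p * z * E q q = z -> z != 0 ->
  exists y, [/\ hspan (- a) y, E q q * y * E p p = y, z * y = E p p & y * z = E q q].
Proof.
move=> [c [hc ->]]; rewrite mxcomb_coef => <- nz.
have cn0 : c p q != 0 by apply: contraNneq nz => ->; rewrite scale0r.
have pq : rep p = rep q.
  by apply: contra_neq_eq nz => pq; rewrite (mxunits_off hE) ?scaler0.
have [b Ab cb] := homogeneous_inv hA (hc p q) cn0.
exists (b *: E q p); split.
- by apply: hspanZE; rewrite [X in gA X](_ : _ = - (a + delta q - delta p)) // opprB opprD addrA (addrC (delta p)).
- by rewrite -scalerAr -scalerAl (mxunitsM hE) // mxunitsMr.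
- by rewrite -scalerAr -scalerAl scalerA (mxunitsM hE) // mulrC cb scale1r.
- by rewrite -scalerAr -scalerAl scalerA (mxunitsM hE) // cb scale1r.
Qed.

Lemma hspan_diag (hA : graded_field gA) a : hspan 0 a ->
  exists w wi v vi t, [/\ [/\ hspan 0 w, hspan 0 wi, w * wi = 1 & wi * w = 1],
    [/\ hspan 0 v, hspan 0 vi, v * vi = 1 & vi * v = 1], uniq t &
    w * a * v = \sum_(p <- t) E p p].
Proof.
move=> ha; apply: (@idempotent_family_diag T D (hspan 0) (fun p => E p p)
  _ _ _ _ _ _ _ (enum D)) ha.
- exact: hspan1.
- by move=> x y; apply: hspanB.
- by move=> x y hx hy; rewrite -[0]addr0; apply: hspanM.
- exact: hspanE0.
- exact: mxunits_idem.
- by move=> p q; apply: mxunitsM0.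
- by move=> p q z hz zE nz; have := hspan_div hA hz zE nz; rewrite oppr0.
- exact: enum_uniq.
- by rewrite -(mxunits1 hE) big_enum.
Qed.

(** * Unit-regularity of shifted matrix rings over a matricial algebra *)

Section MatrixRing.
Variables (hA : graded_field gA) (n : nat) (eps : 'I_n -> Gam).

Definition hspan_mx (x : 'M[T]_n) : Prop := forall i j, hspan (eps i - eps j) (x i j).

Lemma hspan_mx_unit_regular x : hspan_mx x ->
  exists u ui, [/\ hspan_mx u, hspan_mx ui, u * ui = 1, ui * u = 1 & x * u * x = x].
Proof.
move=> hx.
(* The diagonal idempotents of the matrix ring are refined by the [E p p], so that the corner
   between [(l, p)] and [(m, q)] falls under [hspan_div] in degree [eps l - eps m]. *)
pose e (p : 'I_n * D) : 'M[T]_n := \matrix_(i, j) if (i == p.1) && (j == p.1) then E p.2 p.2 else 0.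
have eM p y i j : (e p * y) i j = if i == p.1 then E p.2 p.2 * y p.1 j else 0.
  rewrite mxE (bigD1 p.1) //= !mxE eqxx andbT big1 ?addr0; last first.
    by move=> k /negPf kp; rewrite !mxE kp andbF mul0r.
  by case: eqP; rewrite ?mul0r.
have Me p y i j : (y * e p) i j = if j == p.1 then y i p.1 * E p.2 p.2 else 0.
  rewrite mxE (bigD1 p.1) //= !mxE eqxx big1 ?addr0; last first.
    by move=> k /negPf kp; rewrite !mxE kp mulr0.
  by case: eqP; rewrite ?mulr0.
have eE p i j : e p i j = if (i == p.1) && (j == p.1) then E p.2 p.2 else 0 by rewrite mxE.
apply: (@unit_regular _ _ hspan_mx e _ _ _ _ _ _ _ (enum {: 'I_n * D})) hx.
- move=> i j; rewrite mxE; case: eqP => [->|_]; last exact: hspan0.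
  rewrite subrr; exact: hspan1.
- by move=> y z hy hz i j; rewrite !mxE; apply: hspanB.
- move=> y z hy hz i j; rewrite mxE; apply: hspan_sum => k.
  by have := hspanM (hy i k) (hz k j); rewrite addrA subrK.
- move=> p i j; rewrite eE; case: ifP => [/andP[/eqP-> /eqP->]|_]; last exact: hspan0.
  rewrite subrr; exact: hspanE0.
- move=> p; apply/matrixP => i j; rewrite eM !eE; case: (i == p.1) => //=; rewrite eqxx.
  by case: (j == p.1); rewrite ?mulr0 ?mxunits_idem.
- move=> [l p] [m q] pq; apply/matrixP => i j; rewrite eM !eE /= mxE; case: (i == l) => //.
  case: eqP => [lm|_] /=; last by rewrite mulr0.
  case: (j == m); rewrite ?mulr0 // (mxunitsM0 hE) //.
  by apply: contra pq => /eqP ->; rewrite lm.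
- move=> [l p] [m q] z hz zE nz.
  have zij i j : z i j = if (i == l) && (j == m) then z l m else 0.
    rewrite -{1}zE Me /= eM /=; case: (j == m); last by rewrite andbF.
    rewrite andbT; case: (i == l); last by rewrite mul0r.
    by rewrite -[in RHS]zE Me eM /= !eqxx.
  have zlm : E p p * z l m * E q q = z l m by rewrite -[in RHS]zE Me eM /= !eqxx.
  have nlm : z l m != 0.
    by apply: contraNneq nz => zn; apply/eqP/matrixP => i j; rewrite zij zn mxE if_same.
  have [y [hy yE zy yz]] := hspan_div hA (hz l m) zlm nlm.
  exists (\matrix_(i, j) if (i == m) && (j == l) then y else 0); split.
  + move=> i j; rewrite mxE; case: ifP => [/andP[/eqP-> /eqP->]|_]; last exact: hspan0.
    by rewrite -opprB.
  + apply/matrixP => i j; rewrite Me eM !mxE /= !eqxx.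
    by case: (j == l); case: (i == m); rewrite /= ?mul0r.
  + apply/matrixP => i j; rewrite !mxE /= (bigD1 m) //= big1 ?addr0 => [|k /negPf km].
      rewrite !mxE eqxx zij eqxx andbT /=.
      by case: (i == l); case: (j == l); rewrite ?mul0r ?mulr0.
    by rewrite zij km andbF mul0r.
  + apply/matrixP => i j; rewrite !mxE /= (bigD1 l) //= big1 ?addr0 => [|k /negPf km].
      rewrite !mxE eqxx zij eqxx andbT /=.
      by case: (i == m); case: (j == m); rewrite ?mul0r ?mulr0.
    by rewrite mxE km andbF mul0r.
- exact: enum_uniq.
- rewrite big_enum /=; apply/matrixP => i j; rewrite summxE !mxE.
  rewrite (eq_bigr (fun p => if (i == p.1) && (j == p.1) then E p.2 p.2 else 0)) => [|p _]; last exact: eE.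
  rewrite -(pair_big xpredT xpredT (fun l p => if (i == l) && (j == l) then E p p else 0)) /=.
  rewrite (bigD1 i) //= [X in _ + X]big1 ?addr0 => [|l li]; last first.
    by rewrite big1 // => p _; rewrite eq_sym (negPf li).
  rewrite eqxx eq_sym; case: eqP => _; last by rewrite big1.
  exact: (mxunits1 hE).
Qed.
End MatrixRing.
End MatrixUnits.

(** * Graded modules *)

(* Graded endomorphisms of finitely generated free graded modules are
   unit-regular; this gives the cancellation of graded projective modules. *)
Definition mx_regular (Gam : zmodType) (R : pzRingType) (gR : ring_grading Gam R) : Prop :=
  forall n (eps : 'I_n -> Gam) (x : 'M[R]_n),
  (forall i l, gR (eps i - eps l) (x i l)) -> exists u ui : 'M[R]_n,
  [/\ forall i l, gR (eps i - eps l) (u i l), forall i l, gR (eps i - eps l) (ui i l),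
      u * ui = 1, ui * u = 1 & x * u * x = x].

(** * Fixed points of a graded endomorphism as a graded module *)

Section Fixed.
Variables (K : pzRingType) (X : lmodType K) (p : X -> X).

(** For an idempotent [p] this is its image. The proof of linearity is an argument so that the
    closure instance can be inferred from the predicate. *)
Definition fixpred (lp : linear p) : {pred X} := fun x => p x == x.

Variable lp : linear p.

Fact fixpred_closed : GRing.submod_closed (fixpred lp).
Proof.
have p0 : p 0 = 0 by have := lp (-1) 0 0; rewrite scaler0 addr0 scaleN1r addNr.
split=> [|a x y]; rewrite !unfold_in ?p0 // => /eqP px /eqP py.
by rewrite lp px py.
Qed.
HB.instance Definition _ := GRing.isSubmodClosed.Build K X (fixpred lp) fixpred_closed.

Record fixsub := FixSub { fixval : X; _ : fixval \in fixpred lp }.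
HB.instance Definition _ := [isSub for fixval].
HB.instance Definition _ := [Choice of fixsub by <:].
HB.instance Definition _ := [SubChoice_isSubLmodule of fixsub by <:].

Lemma fixval_linear : linear fixval.
Proof. by []. Qed.

Lemma fixvalP (x : fixsub) : p (fixval x) = fixval x.
Proof. by apply/eqP; have := valP x; rewrite unfold_in. Qed.

Lemma fixval_in x : p x = x -> x \in fixpred lp.
Proof. by move=> px; rewrite unfold_in; apply/eqP. Qed.

End Fixed.
Arguments fixval {K X p lp} _.

Section GradedFixed.
Variables (Gam : zmodType) (R : pzRingType) (gR : ring_grading Gam R).
Local Notation gmod := (gmod gR).
Variables (X : gmod) (p : X -> X) (hp : graded_hom p).

Definition gfix_comp (a : Gam) : set (fixsub hp.1) := [set x | gm_gr X a (fixval x)]%classic.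

Fact gfix_grading : is_grading gfix_comp.
Proof.
have [X0 XB Xs Xi] := gcompP (gm_gr X).
have v0 : fixval (0 : fixsub hp.1) = 0 by apply: gm_linear0 (@fixval_linear _ _ _ hp.1).
have vs I (s : seq I) (F : I -> fixsub hp.1) :
  fixval (\sum_(i <- s) F i) = \sum_(i <- s) fixval (F i).
  by apply: gm_linear_sum (@fixval_linear _ _ _ hp.1).
split=> [a|a x y hx hy|x|s v us hv sv a as_].
- exact: X0.
- exact: (XB a _ _ hx hy).
- have [s [v [us hv xE]]] := homogeneous_decomp (gm_gr X) (fixval x).
  (* The differences [p (v a) - v a] are homogeneous of distinct degrees and sum to [p x - x = 0],
     so the components of a fixed element are fixed. *)
  have pv a : a \in s -> p (v a) = v a.
    move=> as_; apply/eqP; rewrite -subr_eq0; apply/eqP.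
    apply: (Xi s (fun a => p (v a) - v a)) => // [b|].
      by apply: XB => //; apply: hp.2.
    by rewrite big_split /= sumrN -(gm_linear_sum _ _ hp.1) -xE fixvalP subrr.
  pose w a := insubd (0 : fixsub hp.1) (v a).
  have wE a : a \in s -> fixval (w a) = v a.
    by move=> as_; apply: insubdK; apply: (fixval_in hp.1 (pv _ as_)).
  exists [seq w a | a <- s]; split=> [_ /mapP[a as_ ->]|].
    by exists a; rewrite /gfix_comp /= wE.
  apply: val_inj; rewrite big_map /= vs xE.
  by apply: eq_big_seq => a as_; rewrite wE.
- apply: val_inj; apply: (Xi s (fun a => fixval (v a))) => //.
  by rewrite -vs sv v0.
Qed.

Definition gfix : gmod := @GMod _ _ gR (fixsub hp.1) (Grading gfix_grading)
  (fun a b x r hx hr => gm_act (x := fixval x) hx hr).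

Definition gfix_in (x : X) (px : p x = x) : gfix := FixSub (fixval_in hp.1 px).

End GradedFixed.

Section Modules.
Variables (Gam : zmodType) (R : pzRingType) (gR : ring_grading Gam R).
Local Notation gmod := (gmod gR).
Local Notation gproj := (gproj gR).
Implicit Types P Q X W : gmod.

Lemma gm_linearB (U W : lmodType R^c) (f : U -> W) :
  linear f -> forall x y, f (x - y) = f x - f y.
Proof. by move=> lf x y; rewrite -scaleN1r addrC lf scaleN1r addrC. Qed.

Lemma gmod_isoI P Q (f : P -> Q) (g : Q -> P) :
  graded_hom f -> graded_hom g -> cancel f g -> cancel g f -> gmod_iso P Q.
Proof.
move=> [lf hf] [lg hg] fK gK; exists f; split=> //; first by exists g.
by move=> a x; split=> [/hg|/hf //]; rewrite fK.
Qed.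

Lemma gmod_isoE P Q : gmod_iso P Q -> exists (f : P -> Q) (g : Q -> P),
  [/\ graded_hom f, graded_hom g, cancel f g & cancel g f].
Proof.
move=> [f [lf [g fK gK] hf]]; exists f, g; split=> //; first by split=> // a x /hf.
split=> [a x y|a x]; first by apply: (can_inj fK); rewrite lf !gK.
by rewrite -hf gK.
Qed.

Lemma retract_fg P X (i : P -> X) (q : X -> P) :
  linear q -> cancel i q -> fingen X -> fingen P.
Proof.
move=> lq iK [n [g hg]]; exists n, (fun k => q (g k)) => x.
have [r rE] := hg (i x); exists r; rewrite -[LHS]iK rE gm_linear_sum //.
by apply: eq_bigr => k _; rewrite (gm_linearZ lq).
Qed.

Lemma retract_proj P X (i : P -> X) (q : X -> P) :
  graded_hom i -> graded_hom q -> cancel i q ->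
  graded_projective X -> graded_projective P.
Proof.
move=> [li hi] [lq hq] iK pX M N g f hg sg [lf hf].
have hfq : @graded_hom _ _ gR X N (f \o q).
  by split=> [a x y|a x Xx] /=; [rewrite lq lf|apply: hf; apply: hq].
have [h [[lh hh] gh]] := pX _ _ _ _ hg sg hfq.
exists (h \o i); split; last by move=> x /=; rewrite gh /= iK.
by split=> [a x y|a x Px] /=; [rewrite li lh|apply: hh; apply: hi].
Qed.

(** Span of a list: concatenation replaces reindexing when generators are traded for their
    homogeneous components. *)
Fixpoint inspan P (s : seq P) (x : P) : Prop :=
  if s is g :: s' then exists (r : R^c) (y : P), inspan s' y /\ x = r *: g + y
  else x = 0.

Lemma inspan0 P (s : seq P) : inspan s 0.
Proof. by elim: s => //= g s IH; exists 0, 0; rewrite scale0r addr0. Qed.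

Lemma inspanD P (s : seq P) x y : inspan s x -> inspan s y -> inspan s (x + y).
Proof.
elim: s x y => [|g s IH] x y /=; first by move=> -> ->; rewrite addr0.
move=> [r [u [hu ->]]] [t [v [hv ->]]]; exists (r + t), (u + v).
by split; [exact: IH|rewrite scalerDl addrACA].
Qed.

Lemma inspanZ P (s : seq P) a x : inspan s x -> inspan s (a *: x).
Proof.
elim: s x => [|g s IH] x /=; first by move=> ->; rewrite scaler0.
move=> [r [u [hu ->]]]; exists (a * r), (a *: u).
by split; [exact: IH|rewrite scalerDr scalerA].
Qed.

Lemma inspan_mem P (s : seq P) x : x \in s -> inspan s x.
Proof.
elim: s => // g s IH; rewrite inE => /orP[/eqP->|/IH h] /=.
  by exists 1, 0; rewrite scale1r addr0; split=> //; apply: inspan0.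
by exists 0, x; rewrite scale0r add0r.
Qed.

Lemma inspanS P (s t : seq P) x : {subset s <= t} -> inspan s x -> inspan t x.
Proof.
elim: s x => [|g s IH] x st /=; first by move=> ->; apply: inspan0.
move=> [r [u [hu ->]]]; apply: inspanD.
  by apply/inspanZ/inspan_mem/st/mem_head.
by apply: IH => // v vs; apply: st; rewrite inE vs orbT.
Qed.

Lemma inspan_sum P (s : seq P) I (l : seq I) (F : I -> P) :
  (forall i, inspan s (F i)) -> inspan s (\sum_(i <- l) F i).
Proof. by move=> h; elim/big_ind: _ => //; [exact: inspan0|exact: inspanD]. Qed.

Lemma inspanE P (s : seq P) x : inspan s x ->
  exists r : 'I_(size s) -> R^c, x = \sum_i r i *: s`_i.
Proof.
elim: s x => [|g s IH] x /=; first by move=> ->; exists (fun=> 0); rewrite big_ord0.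
move=> [r [u [/IH[t ->] ->]]].
exists (fun i => if unlift ord0 i is Some j then t j else r).
rewrite big_ord_recl unlift_none /=; congr (_ + _).
by apply: eq_bigr => i _; rewrite liftK.
Qed.

Lemma homogeneous_span P (l : seq P) : exists s : seq P,
  (forall v, v \in s -> homogeneous (gm_gr P) v) /\ forall x, x \in l -> inspan s x.
Proof.
elim: l => [|g l [s [hs ls]]]; first by exists [::].
have [t [ht gE]] := grading_span (gcompP (gm_gr P)) g.
exists (t ++ s); split=> [v|x]; first by rewrite mem_cat => /orP[/ht|/hs].
rewrite inE => /orP[/eqP->|/ls]; last first.
  by apply: inspanS => v vs; rewrite mem_cat vs orbT.
rewrite gE; have : {subset t <= t ++ s} by move=> v vt; rewrite mem_cat vt.
elim: {1 4}t => [|v u IH] uts; first by rewrite big_nil; apply: inspan0.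
rewrite big_cons; apply: inspanD; first by apply/inspan_mem/uts/mem_head.
by apply: IH => w wu; apply: uts; rewrite inE wu orbT.
Qed.

Lemma fingen_homogeneous P : fingen P -> exists (n : nat) (eps : 'I_n -> Gam) (g : 'I_n -> P),
  (forall i, gm_gr P (- eps i) (g i)) /\
  forall x, exists r : 'I_n -> R^c, x = \sum_i r i *: g i.
Proof.
move=> [n [g hg]]; have [s [hs gs]] := homogeneous_span (codom g).
have /choice[d hd] (i : 'I_(size s)) : exists a, gm_gr P a s`_i.
  by apply: hs; apply: mem_nth.
exists (size s), (fun i => - d i), (fun i => s`_i); split=> [i|x].
  by rewrite opprK; apply: hd.
have [r ->] := hg x; apply: inspanE; apply: inspan_sum => i.
by apply/inspanZ/gs/codom_f.
Qed.

(** * Graded free modules of finite rank and their matrices *)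

Section Free.
Variables (n : nat) (eps : 'I_n -> Gam).

(** The grading of the direct sum of the shifts [R(eps i)]; the basis vector [i] therefore has
    degree [- eps i], which explains the sign in [fingen_homogeneous]. *)
Definition gfree_comp (a : Gam) : set 'rV[R^c]_n :=
  [set v | forall i, gR (eps i + a) (v 0 i)]%classic.

Lemma gfree_row_sum (v : 'rV[R^c]_n) : v = \sum_i v 0 i *: delta_mx 0 i.
Proof. by rewrite {1}[v]row_sum_delta. Qed.

Fact gfree_grading : is_grading gfree_comp.
Proof.
have [R0 RB Rs Ri] := gcompP gR.
split=> [a i|a x y hx hy i|v|s v us hv sv a as_].
- by rewrite mxE; apply: R0.
- by rewrite !mxE; apply: RB.
- rewrite (gfree_row_sum v); elim/big_rec: _ => [|i x _ [s [hs ->]]].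
    by exists [::]; rewrite big_nil.
  have [t [ht ->]] := Rs (v 0 i).
  exists ([seq (u : R^c) *: delta_mx 0 i | u <- t] ++ s); split=> [w|]; last first.
    by rewrite big_cat big_map /= -scaler_suml.
  rewrite mem_cat => /orP[/mapP[u /ht[b Rb] ->]|/hs //].
  exists (b - eps i) => j; rewrite !mxE /=; case: eqP => [->|_]; last by rewrite mulr0; apply: R0.
  by rewrite mulr1 subrKC.
- apply/rowP => i; rewrite mxE.
  have := Ri [seq eps i + b | b <- s] (fun b => v (b - eps i) 0 i) _ _ _ (eps i + a).
  rewrite addrAC subrr add0r map_inj_uniq; last exact: addrI.
  apply=> // [b||]; last exact: map_f.
    by have := hv (b - eps i) i; rewrite addrC subrK.
  have := congr1 (fun w : 'rV[R^c]_n => w 0 i) sv; rewrite summxE mxE => sv0.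
  by rewrite big_map; under eq_bigr do rewrite addrAC subrr add0r.
Qed.

Fact gfree_act a b (x : 'rV[R^c]_n) (r : R) :
  gfree_comp a x -> gR b r -> gfree_comp (a + b) ((r : R^c) *: x).
Proof. by move=> hx hr i; rewrite mxE addrA; apply: rgradingM. Qed.

Definition gfree : gmod := @GMod _ _ gR 'rV[R^c]_n (Grading gfree_grading) gfree_act.

Lemma gfree_delta l : gm_gr gfree (- eps l) (delta_mx 0 l).
Proof.
move=> i; rewrite mxE /=; case: eqP => [->|_]; last exact: grading0 (gcompP gR) _.
rewrite subrr; exact: rgrading1.
Qed.

Definition mxact (x : 'M[R]_n) (v : gfree) : gfree := \row_i \sum_l x i l * (v 0 l : R).

Lemma mxact_hom (x : 'M[R]_n) : (forall i l, gR (eps i - eps l) (x i l)) -> graded_hom (mxact x).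
Proof.
move=> hx; split=> [a u v|a v hv i].
  have aux (X U V : 'I_n -> R) (b : R) :
      \sum_l X l * (U l * b + V l) = (\sum_l X l * U l) * b + \sum_l X l * V l.
    rewrite mulr_suml -big_split; apply: eq_bigr => l _.
    by rewrite mulrDr mulrA.
  apply/rowP => i; rewrite !mxE -[RHS](aux (x i) (u 0) (v 0) a).
  by apply: eq_bigr => l _; rewrite !mxE.
rewrite mxE; apply: gcomp_sum => l _.
by have := rgradingM (hx i l) (hv l); rewrite addrA subrK.
Qed.

Lemma mxactM x y v : mxact (x * y) v = mxact x (mxact y v).
Proof.
apply/rowP => i; rewrite !mxE.
under eq_bigr do rewrite mxE mulr_suml.
rewrite exchange_big; apply: eq_bigr => l _; rewrite mxE mulr_sumr.
by apply: eq_bigr => k _; rewrite mulrA.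
Qed.

Lemma mxact1 v : mxact 1 v = v.
Proof.
apply/rowP => i; rewrite mxE (bigD1 i) //= mxE eqxx mul1r big1 ?addr0 // => l /negPf li.
by rewrite mxE eq_sym li mul0r.
Qed.

(** Column [l] is the image of the basis vector [l]. With [mxact_hom], the matrices in [mx_regular]
    are exactly the graded endomorphisms of [gfree]. *)
Lemma mxact_matrix (f : gfree -> gfree) : graded_hom f ->
  exists x : 'M[R]_n, (forall i l, gR (eps i - eps l) (x i l)) /\ forall v, f v = mxact x v.
Proof.
move=> [lf hf]; exists (\matrix_(i, l) f (delta_mx 0 l) 0 i); split=> [i l|v].
  by rewrite mxE; apply: hf; apply: gfree_delta.
rewrite {1}(gfree_row_sum v) (gm_linear_sum _ _ lf); apply/rowP => i.
rewrite summxE mxE; apply: eq_bigr => l _; rewrite (gm_linearZ lf) !mxE.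
by [].
Qed.

End Free.

(** Projectivity splits the surjection [q] from the free module by [h]; the complement is the kernel
    of [q], realized as the fixed points of [id - h q]. *)
Lemma fingen_complement P : fingen P -> graded_projective P ->
  exists n (eps : 'I_n -> Gam) (Q : gmod), gmod_iso (dsum P Q) (gfree eps).
Proof.
move=> fP pP; have [n [eps [g [hg gs]]]] := fingen_homogeneous fP.
exists n, eps; pose q (v : gfree eps) : P := \sum_i v 0 i *: g i.
have hq : graded_hom q.
  split=> [a u v|a v hv].
    rewrite /q scaler_sumr -big_split; apply: eq_bigr => i _.
    by rewrite !mxE scalerDl scalerA.
  apply: gcomp_sum => i _; have := gm_act (hg i) (hv i); by rewrite addKr.
have sq x : exists v, q v = x.
  have [r ->] := gs x; exists (\row_i r i).
  by apply: eq_bigr => i _; rewrite mxE.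
have hid : @graded_hom _ _ gR P P id by [].
have [h [hh qh]] := pP _ _ _ _ hq sq hid.
pose p (v : gfree eps) : gfree eps := v - h (q v).
have hp : graded_hom p.
  split=> [a u v|a v hv]; last first.
    by apply: gradingB (gcompP (gm_gr (gfree eps))) _ _ _ hv (hh.2 _ _ (hq.2 _ _ hv)).
  by rewrite /p hq.1 hh.1 scalerBr addrACA opprD.
have qp v : q (p v) = 0 by rewrite (gm_linearB hq.1) qh subrr.
have pp v : p (p v) = p v by rewrite {1}/p qp (gm_linear0 hh.1) subr0.
exists (gfix hp).
apply: (@gmod_isoI (dsum P (gfix hp)) (gfree eps)
  (fun x => h x.1 + fixval x.2) (fun v => (q v, gfix_in hp (pp v)))).
- split=> [a x y|a x [hx hy]].
    by rewrite hh.1 fixval_linear scalerDr addrACA.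
  by apply: gcompD; [apply: hh.2|].
- split=> [a x y|a x hx]; last by split; [apply: hq.2|apply: hp.2].
  by apply/pair_equal_spec; split; [apply: hq.1|apply: val_inj; apply: hp.1].
- move=> [x y] /=; have yE := fixvalP y.
  have qy : q (fixval y) = 0 by rewrite -yE qp.
  have qx : q (h x + fixval y) = x by rewrite (gm_linearD hq.1) qh qy addr0.
  apply/pair_equal_spec; split=> //.
  by apply: val_inj; rewrite /= /p qx addrC addKr.
- by move=> v /=; rewrite /p subrKC.
Qed.

Section Cancellation.
Hypothesis regR : mx_regular gR.

(* The endomorphism [a] of the free module with kernel [f P] and image [g W]
   is unit-regular, [a = a u a], so [u] maps the complement [ker (a u)] of [g W]
   onto [f P]. *)
Lemma gfree_cancel n (eps : 'I_n -> Gam) P P' W :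
  gmod_iso (dsum P W) (gfree eps) -> gmod_iso (dsum P' W) (gfree eps) -> gmod_iso P P'.
Proof.
move=> /gmod_isoE[f [f' [hf hf' fK f'K]]] /gmod_isoE[g [g' [hg hg' gK g'K]]].
have h1 X Y : @graded_hom _ _ gR X (dsum X Y) (fun x => (x, 0)).
  split=> [a x y|a x hx]; first by congr pair; rewrite /= scaler0 addr0.
  by split=> //; apply: grading0 (gcompP (gm_gr Y)) a.
have h2 X Y : @graded_hom _ _ gR Y (dsum X Y) (fun x => (0, x)).
  split=> [a x y|a x hx]; first by congr pair; rewrite /= scaler0 addr0.
  by split=> //; apply: grading0 (gcompP (gm_gr X)) a.
have s1 X Y : @graded_hom _ _ gR (dsum X Y) X fst by split=> // a x [].
have s2 X Y : @graded_hom _ _ gR (dsum X Y) Y snd by split=> // a x [].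
have hC (X Y Z : gmod) (u : Y -> Z) (v : X -> Y) :
    graded_hom u -> graded_hom v -> graded_hom (u \o v).
  move=> [lu hu] [lv hv]; split=> [a x y|a x hx] /=; first by rewrite lv lu.
  by apply: hu; apply: hv.
pose a : gfree eps -> gfree eps := g \o ((fun w => (0, w)) \o (snd \o f')).
have ha : graded_hom a.
  exact: (hC _ _ _ _ _ hg (hC _ _ _ _ _ (h2 _ _) (hC _ _ _ _ _ (s2 _ _) hf'))).
have [x [hx ax]] := mxact_matrix ha.
have [u [ui [hu hui uK Ku xux]]] := regR hx.
have [lU hU] := mxact_hom hu; have [lUi hUi] := mxact_hom hui.
set U := mxact u in lU hU; set Ui := mxact ui in lUi hUi.
have UK v : U (Ui v) = v by rewrite /U /Ui -mxactM uK mxact1.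
have KU v : Ui (U v) = v by rewrite /U /Ui -mxactM Ku mxact1.
have aUa v : a (U (a v)) = a v by rewrite !ax /U -!mxactM xux.
have la := ha.1.
(* [a U] is idempotent with the same image [g W] as [a]; [k] is the complementary projection, onto
   the kernel of [a U]. *)
pose k v := v - a (U v).
have hk : graded_hom k.
  split=> [b v w|b v hv]; first by rewrite /k lU la scalerBr addrACA opprD.
  by apply: gradingB (gcompP (gm_gr (gfree eps))) _ _ _ hv (ha.2 _ _ (hU _ _ hv)).
(* The kernel of [a U] and [g P'] are both complements of [g W]. Projecting along [g W] identifies
   them, by [k] one way and by the first component of [g'] the other way. *)
apply: (@gmod_isoI P P' (fst \o (g' \o (Ui \o (f \o (fun p => (p, 0))))))
  (fst \o (f' \o (U \o (k \o (g \o (fun p => (p, 0)))))))).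
- exact: (hC _ _ _ _ _ (s1 _ _) (hC _ _ _ _ _ hg' (hC _ _ _ _ _ (mxact_hom hui)
    (hC _ _ _ _ _ hf (h1 _ _))))).
- exact: (hC _ _ _ _ _ (s1 _ _) (hC _ _ _ _ _ hf' (hC _ _ _ _ _ (mxact_hom hu)
    (hC _ _ _ _ _ hk (hC _ _ _ _ _ hg (h1 _ _)))))).
- move=> p /=; set z := f (p, 0); pose v := Ui z; pose w := (g' v).2.
  have vE : v = g ((g' v).1, 0) + g (0, w).
    rewrite -(gm_linearD hg.1) -{1}[v]g'K; congr g.
    by rewrite {1}[g' v]surjective_pairing; congr pair; rewrite /= ?addr0 ?add0r.
  have gw : g (0, w) = a (f (0, w)) by rewrite /a /= fK.
  have aUv : a (U v) = 0.
    by rewrite /v UK /a /= /z fK /= (gm_linear0 (f := g) hg.1).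
  have -> : k (g ((g' (Ui z)).1, 0)) = v.
    have -> : g ((g' (Ui z)).1, 0) = v - a (f (0, w)) by rewrite -gw {1}vE addrK.
    by rewrite (gm_linearB hk.1) {2}/k aUa subrr subr0 /k aUv subr0.
  by rewrite /v UK /z fK.
- move=> p' /=; set z := g (p', 0); pose y := U (k z).
  have ay : a y = 0 by rewrite /y /k (gm_linearB lU) (gm_linearB la) aUa subrr.
  have f'y : (f' y).2 = 0.
    have : (0, (f' y).2) = 0 :> dsum P' W.
      by rewrite -[LHS]gK -[g _]/(a y) ay (gm_linear0 (f := g') hg'.1).
    by case.
  have -> : f ((f' y).1, 0) = y by rewrite -f'y -surjective_pairing f'K.
  rewrite KU /k (gm_linearB hg'.1) /z gK /a /= gK /= subr0 //.
Qed.

(** A complement [Z] of [dsum P Q] in a free module reduces the claim to cancelling [dsum Q Z] from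
    two decompositions of that free module. *)
Lemma gmod_cancel P P' Q : fingen (dsum P Q) -> graded_projective (dsum P Q) ->
  gmod_iso (dsum P Q) (dsum P' Q) -> gmod_iso P P'.
Proof.
move=> fX pX PQ; have [n [eps [Z XZ]]] := fingen_complement fX pX.
apply: (@gfree_cancel _ eps P P' (dsum Q Z)).
  exact: gmod_iso_trans (dsumA _ _ _) XZ.
apply: gmod_iso_trans (dsumA _ _ _) _; apply: gmod_iso_trans _ XZ.
by apply: dsum_iso; [apply: gmod_iso_sym|apply: gmod_iso_refl].
Qed.

End Cancellation.
End Modules.

(** * Classes of homogeneous idempotents in the graded Grothendieck group *)

Section ZgModule.
Variables (Gam : zmodType) (K : zgmodule Gam).
Implicit Types x y z : K.

Lemma zadd0r x : zadd x (zzero K) = x.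
Proof. by rewrite zaddC zadd0. Qed.

Lemma zaddI x y z : zadd x y = zadd x z -> y = z.
Proof. by move=> /(congr1 (zadd (zopp x))); rewrite !zaddA zaddN !zadd0. Qed.

Definition zsum (I : Type) (s : seq I) (u : I -> K) : K :=
  foldr (fun i z => zadd (u i) z) (zzero K) s.

End ZgModule.

Section K0.
Variables (Gam : zmodType) (R : pzRingType) (gR : ring_grading Gam R).
Local Notation gmod := (gmod gR).
Local Notation gproj := (gproj gR).
Local Notation K := (K0gr gR).
Implicit Types P Q : gproj.

Lemma K0gr_class_iso P Q : gmod_iso P Q -> K0gr_class P = K0gr_class Q.
Proof. by move=> PQ; congr gc_in; apply/qclass_eq. Qed.

Lemma K0gr_class_sum P Q :
  K0gr_class (gproj_sum P Q) = zadd (K0gr_class P) (K0gr_class Q).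
Proof. by rewrite /= gc_addE /= vgr_addE vgr_add0. Qed.

Lemma K0gr_class_shift a P : K0gr_class (gproj_shift a P) = zact a (K0gr_class P).
Proof. by rewrite /= gc_actE /= vgr_actE vgr_act_zero. Qed.

Lemma K0gr_posD (x y : K) : K0gr_pos x -> K0gr_pos y -> K0gr_pos (zadd x y).
Proof. by move=> [P ->] [Q ->]; exists (gproj_sum P Q); rewrite K0gr_class_sum. Qed.

Lemma K0gr_pos0 : K0gr_pos (zzero K).
Proof. by exists (gproj0 gR). Qed.

Lemma K0gr_pos_sum (I : Type) (s : seq I) (u : I -> K) :
  (forall i, K0gr_pos (u i)) -> K0gr_pos (zsum s u).
Proof.
by move=> hu; elim: s => [|i s IH] /=; [exact: K0gr_pos0|exact: K0gr_posD].
Qed.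

Section Idempotents.

Definition hidem (e : R) : Prop := gR 0 e /\ e * e = e.

Lemma hidem1 : hidem 1.
Proof. by split; [exact: rgrading1|rewrite mulr1]. Qed.

Lemma hidem0 : hidem 0.
Proof. by split; [exact: grading0 (gcompP gR) 0|rewrite mulr0]. Qed.

Lemma hidemD e e' : hidem e -> hidem e' -> e * e' = 0 -> e' * e = 0 -> hidem (e + e').
Proof.
move=> [R0e ee] [R0e' e'e'] ee' e'e; split; first exact: gcompD.
by rewrite mulrDl !mulrDr ee ee' e'e e'e' add0r addr0.
Qed.

Definition lmul_reg (e : R) (r : greg gR) : greg gR := e * (r : R).

Lemma lmul_reg_hom e : gR 0 e -> graded_hom (lmul_reg e).
Proof.
move=> Re; split=> [a x y|a x Rx].
  have aux (b u v : R) : e * (u * b + v) = (e * u) * b + e * v by rewrite mulrDr mulrA.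
  exact: aux.
by rewrite -[a]add0r; apply: rgradingM.
Qed.

Lemma reg_linear (k : greg gR -> greg gR) : linear k ->
  forall r : R, (k r : R) = (k (1 : R) : R) * r.
Proof.
move=> lk r; have := gm_linearZ lk (r : R^c) (1 : R).
by rewrite -[X in k X]/((1 : R) * r) mul1r.
Qed.

Variables (e : R) (he : hidem e).

Definition idem_gmod : gmod := gfix (lmul_reg_hom he.1).

Lemma idem_gmodP (x : idem_gmod) : e * (fixval x : R) = fixval x.
Proof. exact: fixvalP x. Qed.

Definition idem_in (x : R) (ex : e * x = x) : idem_gmod :=
  gfix_in (lmul_reg_hom he.1) ex.

Lemma idem_retract (r : R) : e * (e * r) = e * r.
Proof. by rewrite mulrA he.2. Qed.

Definition idem_pr (r : greg gR) : idem_gmod := idem_in (idem_retract (r : R)).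

Lemma idem_pr_hom : graded_hom idem_pr.
Proof.
have [l h] := lmul_reg_hom he.1; split=> [a x y|a x hx]; last exact: h.
by apply: val_inj; apply: l.
Qed.

Lemma idem_prK (x : idem_gmod) : idem_pr (fixval x) = x.
Proof. by apply: val_inj; apply: idem_gmodP. Qed.

Lemma fixval_idem_hom : @graded_hom _ _ gR idem_gmod (greg gR) fixval.
Proof. by split=> // a x y; apply: fixval_linear. Qed.

Fact idem_fg : fingen idem_gmod.
Proof. exact: (retract_fg idem_pr_hom.1 idem_prK (greg_fg gR)). Qed.

Fact idem_proj : graded_projective idem_gmod.
Proof.
exact: (retract_proj fixval_idem_hom idem_pr_hom idem_prK (@greg_proj _ _ gR)).
Qed.

Definition idem_gproj : gproj := GProj idem_fg idem_proj.

End Idempotents.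

(** [idem_pr hd 1] is the generator [d] of [dR], so maps between such modules are left
    multiplications by the image of the generator. *)
Lemma idem_linear d d' (hd : hidem d) (hd' : hidem d')
    (k : idem_gmod hd -> idem_gmod hd') (r : idem_gmod hd) :
  linear k -> (fixval (k r) : R) = (fixval (k (idem_pr hd (1 : R))) : R) * (fixval r : R).
Proof.
move=> lk; rewrite -{1}[r]idem_prK.
apply: (@reg_linear (fun s => fixval (k (idem_pr hd s)))) => a u v.
by rewrite (idem_pr_hom hd).1 lk fixval_linear.
Qed.

(** The class of [eR]. The value zero off homogeneous idempotents makes it total, so that classes
    can be summed and rewritten without carrying proofs of [hidem]. *)
Definition cls (e : R) : K :=
  if pselect (hidem e) is left he then K0gr_class (idem_gproj he) else zzero K.

Lemma clsE e (he : hidem e) : cls e = K0gr_class (idem_gproj he).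
Proof.
rewrite /cls; case: pselect => // he'; congr (K0gr_class (idem_gproj _)).
exact: Prop_irrelevance.
Qed.

Lemma cls_pos e : K0gr_pos (cls e).
Proof.
by rewrite /cls; case: pselect => [he|_]; [exists (idem_gproj he)|exact: K0gr_pos0].
Qed.

Lemma cls1 : cls 1 = K0gr_unit gR.
Proof.
rewrite (clsE hidem1); apply: K0gr_class_iso.
have K1 : cancel (idem_pr hidem1) fixval by move=> x; apply: (mul1r (x : R)).
exact: (gmod_isoI (fixval_idem_hom hidem1) (idem_pr_hom hidem1) (@idem_prK _ hidem1) K1).
Qed.

(** Left multiplication by [x] maps [eR] isomorphically onto the shift of [e'R] by [al]; its inverse
    is left multiplication by [y]. *)
Lemma cls_shift al e e' x y : hidem e -> hidem e' -> gR al x -> gR (- al) y ->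
  x * y = e' -> y * x = e -> cls e = zact al (cls e').
Proof.
move=> he he' Rx Ry xy yx; rewrite (clsE he) (clsE he') -K0gr_class_shift.
have h1 (r : idem_gmod he) : e' * (x * (fixval r : R)) = x * (fixval r : R).
  by rewrite -xy -!mulrA (mulrA y) yx idem_gmodP.
have h2 (r : idem_gmod he') : e * (y * (fixval r : R)) = y * (fixval r : R).
  by rewrite -yx -!mulrA (mulrA x) xy idem_gmodP.
have aux (z b u v : R) : z * (u * b + v) = (z * u) * b + z * v by rewrite mulrDr mulrA.
apply: K0gr_class_iso; apply: (@gmod_isoI _ _ _ (idem_gmod he) (gmod_shift al (idem_gmod he'))
  (fun r => idem_in he' (h1 r)) (fun r => idem_in he (h2 r))).
- split=> [a u v|a u hu]; first by apply: val_inj; apply: aux.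
  exact: (rgradingM Rx hu).
- split=> [a u v|a u hu]; first by apply: val_inj; apply: aux.
  by have := rgradingM Ry hu; rewrite addKr.
- by move=> r; apply: val_inj; rewrite /= mulrA yx; apply: idem_gmodP.
- by move=> r; apply: val_inj; rewrite /= mulrA xy; apply: idem_gmodP.
Qed.

Lemma cls_equiv e e' x y : hidem e -> hidem e' -> gR 0 x -> gR 0 y ->
  x * y = e' -> y * x = e -> cls e = cls e'.
Proof.
move=> he he' Rx Ry xy yx; rewrite -[cls e']zact0; apply: (cls_shift (x := x) (y := y)) => //.
by rewrite oppr0.
Qed.

Lemma clsD e e' : hidem e -> hidem e' -> e * e' = 0 -> e' * e = 0 ->
  cls (e + e') = zadd (cls e) (cls e').
Proof.
move=> he he' ee' e'e; have hs := hidemD he he' ee' e'e.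
rewrite (clsE he) (clsE he') (clsE hs) -K0gr_class_sum; apply: K0gr_class_iso.
have h (r1 : idem_gmod he) (r2 : idem_gmod he') :
    (e + e') * ((fixval r1 : R) + fixval r2) = (fixval r1 : R) + fixval r2.
  have o1 : e' * (fixval r1 : R) = 0 by rewrite -(idem_gmodP r1) mulrA e'e mul0r.
  have o2 : e * (fixval r2 : R) = 0 by rewrite -(idem_gmodP r2) mulrA ee' mul0r.
  by rewrite mulrDr !mulrDl !idem_gmodP o1 o2 addr0 add0r.
have [p1 h1] := idem_pr_hom he; have [p2 h2] := idem_pr_hom he'.
apply: (@gmod_isoI _ _ _ (idem_gmod hs) (dsum (idem_gmod he) (idem_gmod he'))
  (fun r => (idem_pr he (fixval r), idem_pr he' (fixval r)))
  (fun r => idem_in hs (h r.1 r.2))).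
- split=> [a u v|a u hu]; last by split; [apply: h1|apply: h2].
  by congr pair; [rewrite fixval_linear p1|rewrite fixval_linear p2].
- split=> [a u v|a u [hu1 hu2]]; last exact: (@gcompD _ _ gR a _ _ hu1 hu2).
  apply: val_inj; rewrite /= scalerDr addrACA //.
- move=> r; apply: val_inj; rewrite /= /lmul_reg -mulrDl; exact: (idem_gmodP r).
- move=> [r1 r2] /=; congr pair; apply: val_inj => /=.
    rewrite /lmul_reg [LHS]mulrDr idem_gmodP -[fixval r2](idem_gmodP r2) mulrA ee' mul0r addr0 //.
  rewrite /lmul_reg [LHS]mulrDr idem_gmodP -[fixval r1](idem_gmodP r1) mulrA e'e mul0r add0r //.
Qed.

Lemma cls0 : cls 0 = zzero K.
Proof.
have := clsD hidem0 hidem0; rewrite mulr0 addr0 => /(_ erefl erefl) h.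
by apply: (@zaddI _ _ (cls 0)); rewrite zadd0r -h.
Qed.

Lemma hidem_sum (I : eqType) (s : seq I) (e : I -> R) : uniq s ->
  (forall i, hidem (e i)) -> (forall i j, i != j -> e i * e j = 0) ->
  hidem (\sum_(i <- s) e i) /\ cls (\sum_(i <- s) e i) = zsum s (fun i => cls (e i)).
Proof.
move=> us he eo; elim: s us => [|i s IH] /=; first by rewrite big_nil; split; [exact: hidem0|exact: cls0].
move=> /andP[ni /IH[hs cs]]; rewrite big_cons.
have o1 : e i * (\sum_(j <- s) e j) = 0.
  by rewrite mulr_sumr big1_seq // => j /andP[_ js]; apply: eo; apply: contraNneq ni => ->.
have o2 : (\sum_(j <- s) e j) * e i = 0.
  by rewrite mulr_suml big1_seq // => j /andP[_ js]; apply: eo; apply: contraNneq ni => <-.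
by split; [exact: hidemD|rewrite clsD // cs].
Qed.

Hypothesis regR : mx_regular gR.

(** Equality in a group completion gives an isomorphism only after adding some projective [Z], which
    cancellation removes. *)
Lemma K0gr_class_inj P Q : K0gr_class P = K0gr_class Q -> gmod_iso P Q.
Proof.
move=> /qclass_eq[k] /=; have [Z ->] := Defs.quotP k.
rewrite !vgr_add0 !vgr_addE => /qclass_eq /= PQ.
apply: (gmod_cancel regR) PQ.
  exact: dsum_fg (gp_fg P) (gp_fg Z).
exact: dsum_proj (@gp_proj _ _ _ P) (@gp_proj _ _ _ Z).
Qed.

(** Converse of [cls_shift]: the classes agree through an actual isomorphism, and [x] and [y] are
    the images of the generators under it and its inverse. *)
Lemma cls_shiftP al e e' : hidem e -> hidem e' -> cls e = zact al (cls e') ->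
  exists x y, [/\ gR al x, gR (- al) y, x * y = e', y * x = e & e' * x * e = x /\ e * y * e' = y].
Proof.
move=> he he'; rewrite (clsE he) (clsE he') -K0gr_class_shift.
move=> /K0gr_class_inj/gmod_isoE[f [g [[lf hf] [lg hg] fK gK]]].
have fE := fun r => @idem_linear _ _ he he' f r lf.
have gE := fun r => @idem_linear _ _ he' he g r lg.
set i := idem_pr he _ in fE; set i' := idem_pr he' _ in gE.
have iE : fixval i = e :> R by exact: mulr1.
have i'E : fixval i' = e' :> R by exact: mulr1.
exists (fixval (f i)), (fixval (g i')).
split.
- have hi : gm_gr (idem_gproj he) 0 i by change (gR 0 (fixval i : R)); rewrite iE; exact: he.1.
  by have := hf 0 i hi; rewrite /= /shift_comp /= addr0.
- apply: (hg _ i'); change (gR (al - al) (fixval i' : R)); rewrite subrr i'E; exact: he'.1.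
- by rewrite -fE gK.
- by rewrite -gE fK.
- split; rewrite idem_gmodP.
    by have := fE i; rewrite iE.
  by have := gE i'; rewrite i'E.
Qed.

(** The idempotent endomorphism [j q] of [eR] is left multiplication by [e1 = j (q e)]. *)
Lemma cls_summand e (he : hidem e) P (j : P -> idem_gmod he) (q : idem_gmod he -> P) :
  graded_hom j -> graded_hom q -> cancel j q ->
  exists e1, [/\ hidem e1, cls e1 = K0gr_class P, e * e1 = e1, e1 * e = e1 &
    forall r, (fixval (j (q r)) : R) = e1 * (fixval r : R)].
Proof.
move=> [lj hj] [lq hq] jK.
have ljq : linear (j \o q) by move=> a x y; rewrite /= lq lj.
have jqE := fun r => @idem_linear _ _ he he (j \o q) r ljq.
rewrite /= in jqE; set i := idem_pr he _ in jqE; pose e1 : R := fixval (j (q i)).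
have Ri : gm_gr (idem_gmod he) 0 i.
  by change (gR 0 (e * 1)); rewrite mulr1; exact: he.1.
have ee1 : e * e1 = e1 by apply: idem_gmodP.
have he1 : hidem e1 by split; [exact: (hj _ _ (hq _ _ Ri))|rewrite -jqE jK].
have pr1 (x : P) : e1 * (fixval (j x) : R) = fixval (j x) by rewrite -jqE jK.
have iE : fixval i = e :> R by exact: mulr1.
have e1e : e1 * e = e1 by have := jqE i; rewrite iE => <-.
exists e1; split=> //; rewrite (clsE he1); apply: K0gr_class_iso.
have [lp hp] := idem_pr_hom he.
apply: (@gmod_isoI _ _ _ (idem_gmod he1) P (fun r => q (idem_pr he (fixval r)))
  (fun x => idem_in he1 (pr1 x))).
- split=> [a x y|a x hx]; first by rewrite fixval_linear lp lq.
  exact/hq/hp.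
- split=> [a x y|a x hx]; last exact: hj.
  by apply: val_inj; rewrite [RHS]fixval_linear /= lj.
- move=> r; apply: val_inj; rewrite /= jqE -/e1.
  change (e1 * (e * (fixval r : R)) = fixval r).
  by rewrite mulrA e1e idem_gmodP.
- by move=> x /=; rewrite idem_prK jK.
Qed.

(** By cancellation the sum of classes is an actual decomposition of [eR], whose two projections are
    left multiplications by [e1] and [e2]. *)
Lemma cls_split e u v : hidem e -> K0gr_pos u -> K0gr_pos v -> cls e = zadd u v ->
  exists e1 e2, [/\ hidem e1 /\ cls e1 = u, hidem e2 /\ cls e2 = v,
    e1 * e2 = 0, e2 * e1 = 0 & e = e1 + e2].
Proof.
move=> he [P ->] [Q ->]; rewrite (clsE he) -K0gr_class_sum.
move=> /K0gr_class_inj/gmod_isoE[f [g [[lf hf] [lg hg] fK gK]]].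
have [e1 [he1 c1 l1 r1 E1]] : exists e1, [/\ hidem e1, cls e1 = K0gr_class P, e * e1 = e1, e1 * e = e1 &
    forall r, (fixval (g ((f r).1, 0)) : R) = e1 * (fixval r : R)].
  apply: (@cls_summand e he P (fun x => g (x, 0)) (fun r => (f r).1)).
  - split=> [a x y|a x hx].
      by rewrite -lg; congr g; congr pair; rewrite /= scaler0 addr0.
    by apply: hg; split=> //; exact: grading0 (gcompP (gm_gr Q)) a.
  - by split=> [a x y|a x /hf[]] //; rewrite lf.
  - by move=> x; rewrite gK.
have [e2 [he2 c2 l2 r2 E2]] : exists e2, [/\ hidem e2, cls e2 = K0gr_class Q, e * e2 = e2, e2 * e = e2 &
    forall r, (fixval (g (0, (f r).2)) : R) = e2 * (fixval r : R)].
  apply: (@cls_summand e he Q (fun x => g (0, x)) (fun r => (f r).2)).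
  - split=> [a x y|a x hx].
      by rewrite -lg; congr g; congr pair; rewrite /= scaler0 addr0.
    by apply: hg; split=> //; exact: grading0 (gcompP (gm_gr P)) a.
  - by split=> [a x y|a x /hf[]] //; rewrite lf.
  - by move=> x; rewrite gK.
pose i := idem_pr he (1 : R).
have iE : fixval i = e :> R by exact: mulr1.
have g0 : g (0, 0) = 0 := gm_linear0 lg.
have ie1 : fixval (g ((f i).1, 0)) = e1 :> R by rewrite E1 iE.
have ie2 : fixval (g (0, (f i).2)) = e2 :> R by rewrite E2 iE.
have f1 : f (g ((f i).1, 0)) = ((f i).1, 0) by rewrite gK.
have f2 : f (g (0, (f i).2)) = (0, (f i).2) by rewrite gK.
exists e1, e2; split=> //.
- by rewrite -[e2]ie2 -E1 f2 /= g0.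
- by rewrite -[e1]ie1 -E2 f1 /= g0.
- have fi : f i = 1 *: (((f i).1, 0) : dsum P Q) + (0, (f i).2).
    by rewrite scale1r {1}[f i]surjective_pairing; congr pair; rewrite /= ?addr0 ?add0r.
  have := congr1 fixval (congr1 g fi); rewrite fK lg scale1r.
  by rewrite -[X in _ = X]/(fixval (g ((f i).1, 0)) + fixval (g (0, (f i).2)) : R) ie1 ie2 iE.
Qed.

Lemma cls_splits (I : eqType) (s : seq I) (u : I -> K) e : hidem e -> uniq s ->
  (forall i, K0gr_pos (u i)) -> cls e = zsum s u ->
  exists g : I -> R, [/\ forall i, i \in s -> hidem (g i) /\ cls (g i) = u i,
    forall i j, i \in s -> j \in s -> i != j -> g i * g j = 0,
    e = \sum_(i <- s) g i & forall i, i \in s -> e * g i = g i /\ g i * e = g i].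
Proof.
move=> he us hu; elim: s e he us => [|i s IH] e he /=.
  move=> _ ce; exists (fun=> 0); split=> //; rewrite big_nil.
  (* An idempotent of class zero is linked to the idempotent [0], hence vanishes. *)
  have [] := cls_shiftP (al := 0) he hidem0; first by rewrite zact0 cls0 ce.
  by move=> x [y [_ _ _ <- [<- _]]]; rewrite !mul0r mulr0.
move=> /andP[ni us] ce; have [e1 [e2 [[he1 c1] [he2 c2] e12 e21 eE]]] :=
  cls_split he (hu i) (K0gr_pos_sum _ hu) ce.
have [g [hg go gE ge]] := IH e2 he2 us c2.
have ge1 j : j \in s -> e1 * g j = 0 /\ g j * e1 = 0.
  move=> /ge[a b]; split; first by rewrite -a mulrA e12 mul0r.
  by rewrite -b -mulrA e21 mulr0.
have ij j : j \in s -> (j == i) = false by move=> js; apply: contraNF ni => /eqP <-.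
exists (fun j => if j == i then e1 else g j); split.
- by move=> j; rewrite inE; case: eqP => [->|_] //= /hg.
- move=> j k; rewrite !inE; case: eqP => [->|_] /=; case: eqP => [->|_] //=; first by rewrite eqxx.
  + by move=> _ /ge1[].
  + by move=> /ge1[].
  + exact: go.
- rewrite big_cons eqxx eE gE; congr (_ + _).
  by apply: eq_big_seq => j /ij ->.
- move=> j; rewrite inE eE; case: eqP => [_ _|_ /=].
    by rewrite mulrDl mulrDr e12 e21 he1.2 !addr0.
  move=> js; have [g1 g2] := ge1 _ js; have [g3 g4] := ge _ js.
  by rewrite mulrDl mulrDr g1 g2 g3 g4 !add0r.
Qed.

End K0.

(** * Matricial subalgebras *)

Section MxComb.
Variables (A : comNzRingType) (T : algType A) (D : finType) (rep : D -> D).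
Variables (E : D -> D -> T) (hE : mxunits rep E).

Lemma mxcombM c d : mxcomb E c * mxcomb E d =
  mxcomb E (fun p s => \sum_q if rep p == rep q then c p q * d q s else 0).
Proof.
rewrite mulr_suml; apply: eq_bigr => p _.
under [RHS]eq_bigr do rewrite scaler_suml.
rewrite [RHS]exchange_big mulr_suml; apply: eq_bigr => q _.
rewrite mulr_sumr (bigD1 q) //= [X in _ + X]big1 ?addr0 => [|r rq]; last first.
  rewrite mulr_sumr big1 // => s _.
  by rewrite -scalerAl -scalerAr (mxunitsM0 hE) 1?eq_sym // !scaler0.
rewrite mulr_sumr; apply: eq_bigr => s _; rewrite -scalerAl -scalerAr scalerA.
case: eqP => [pq|/eqP pq]; first by rewrite (mxunitsM hE).
by rewrite (mxunits_off hE pq) mul0r scaler0 scale0r.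
Qed.

Lemma mxcomb1 : mxcomb E (fun p q => if p == q then 1 else 0) = 1.
Proof.
rewrite -(mxunits1 hE); apply: eq_bigr => p _.
rewrite (bigD1 p) //= eqxx scale1r big1 ?addr0 // => q /negPf qp.
by rewrite eq_sym qp scale0r.
Qed.

Lemma mxcomb_sum (I : finType) (c : I -> A) (d : I -> D -> D -> A) :
  \sum_i c i *: mxcomb E (d i) = mxcomb E (fun r s => \sum_i c i * d i r s).
Proof.
under eq_bigr do rewrite mxcombZ.
rewrite exchange_big; apply: eq_bigr => p _; rewrite exchange_big; apply: eq_bigr => q _.
by rewrite scaler_suml.
Qed.

End MxComb.

Section MatricialUnits.
Variables (A : comNzRingType) (l : nat) (n : 'I_l.+1 -> nat).
Local Notation M := (mprod A n).
Local Notation D := {k : 'I_l.+1 & 'I_(n k).+1}.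
Local Notation ix k i := (existT (fun h : 'I_l.+1 => 'I_(n h).+1) k i : D).

Definition munit (p q : D) : M :=
  fun k => \matrix_(i, j) ((ix k i == p) && (ix k j == q))%:R.

Definition mrep (p : D) : D := ix (tag p) ord0.

(** When [p] and [q] lie in different blocks, [tagged_as] returns an arbitrary index; the value is
    harmless because [munit p q] is then zero. *)
Definition mcoef (x : M) (p q : D) : A := x (tag p) (tagged p) (tagged_as p q).

Lemma mprodP (x y : M) : (forall k i j, x k i j = y k i j) -> x = y.
Proof. by move=> xy; apply: functional_extensionality_dep => k; apply/matrixP. Qed.

Lemma mprod_sumE (I : Type) (s : seq I) (F : I -> M) k i j :
  (\sum_(a <- s) F a) k i j = \sum_(a <- s) F a k i j.
Proof.
elim: s => [|a s IH]; first by rewrite !big_nil /= mxE.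
by rewrite !big_cons -IH -[LHS]/((F a k + (\sum_(a <- s) F a) k) i j) mxE.
Qed.

Lemma mcoefK x : mxcomb munit (mcoef x) = x.
Proof.
apply: mprodP => k i j; rewrite mprod_sumE (bigD1 (ix k i)) //= [X in _ + X]big1 ?addr0.
  rewrite mprod_sumE (bigD1 (ix k j)) //= [X in _ + X]big1 ?addr0.
    rewrite -[LHS]/((mcoef x (ix k i) (ix k j) *: munit (ix k i) (ix k j) k) i j) !mxE !eqxx mulr1.
    by rewrite /mcoef /= tagged_asE.
  move=> q qj; rewrite -[LHS]/((mcoef x (ix k i) q *: munit (ix k i) q k) i j) !mxE.
  by rewrite [ix k j == q]eq_sym (negPf qj) andbF mulr0.
move=> p pi; rewrite mprod_sumE big1 // => q _.
rewrite -[LHS]/((mcoef x p q *: munit p q k) i j) !mxE.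
by rewrite [ix k i == p]eq_sym (negPf pi) mulr0.
Qed.

Lemma munit_units : mxunits mrep munit.
Proof.
split=> [p q pq|p q s pq|p q r s qr|].
- apply: mprodP => k i j; rewrite -[RHS]/((0 : 'M[A]_((n k).+1)) i j) !mxE.
  case: eqP => [pE|] //=; case: eqP => [qE|] //=.
  by rewrite -pE -qE /mrep eqxx in pq.
- apply: mprodP => k i j; rewrite -[LHS]/((munit p q k * munit q s k) i j) !mxE.
  case: p q pq => [k1 a] [k2 b] /(congr1 tag) /= k12; case: k2 / k12 b => b.
  have [pE|pE] := eqVneq (ix k i) (ix k1 a); last first.
    by rewrite big1 // => h _; rewrite !mxE (negPf pE) mul0r.
  have kk : k = k1 := congr1 tag pE; case: k1 / kk a b pE => a b pE.
  rewrite (bigD1 b) //= big1 ?addr0 => [|h hb].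
    by rewrite !mxE pE !eqxx /= mul1r.
  rewrite !mxE [ix k h == _](_ : _ = false) ?andbF ?mul0r //.
  by apply: contraNF hb => /eqP /eqP; rewrite eq_Tagged.
- apply: mprodP => k i j; rewrite -[LHS]/((munit p q k * munit r s k) i j) !mxE.
  rewrite big1 // => h _; rewrite !mxE.
  case: (eqVneq (ix k h) q) => [hq|_]; last by rewrite andbF mul0r.
  by rewrite hq (negPf qr) mulr0.
- apply: mprodP => k i j; rewrite mprod_sumE (bigD1 (ix k i)) //= big1 ?addr0.
    rewrite -[RHS]/((1 : 'M[A]_((n k).+1)) i j) !mxE eqxx eq_Tagged /= eq_sym //.
  by move=> p pi; rewrite !mxE eq_sym (negPf pi).
Qed.

End MatricialUnits.

Section GradedUnits.
Variables (Gam : zmodType) (A : comNzRingType) (gA : ring_grading Gam A).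
Variables (R : algType A) (gR : alg_grading gA R).

Record gmxunits (D : finType) (rep : D -> D) (delta : D -> Gam) (E : D -> D -> R) : Prop :=
  GMxUnits {
    gmxunits_units :> mxunits rep E;
    gmxunits_rep : forall p, rep (rep p) = rep p;
    gmxunits_deg : forall p q, gR (delta p - delta q) (E p q) }.

(** For matrix units this excludes zero blocks and makes coefficients within a block unique. *)
Definition mxfaithful (D : finType) (E : D -> D -> R) : Prop :=
  forall c p, c *: E p p = 0 -> c = 0.

Section Family.
Variables (D : finType) (rep : D -> D) (delta : D -> Gam) (E : D -> D -> R).
Hypothesis hE : gmxunits rep delta E.

Lemma gmxunits_hidem p : hidem gR (E p p).
Proof.
split; last exact: mxunits_idem hE p.
by rewrite -[0](subrr (delta p)); apply: gmxunits_deg hE _ _.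
Qed.

Lemma hspan_degree a x : hspan gA E delta a x -> gR a x.
Proof.
move=> [c [hc ->]]; apply: gcomp_sum => p _; apply: gcomp_sum => q _.
have := agradingZ (hc p q) (gmxunits_deg hE p q).
by rewrite addrA subrK addrK.
Qed.

(** The given [c] need not be homogeneous. Cutting by [E p p] and [E q q] isolates [c p q *: E p q],
    of degree [a], so [c p q] may be replaced by its component of the right degree. *)
Lemma degree_hspan a c : gR a (mxcomb E c) -> hspan gA E delta a (mxcomb E c).
Proof.
move=> Rx; have /choice[d hd] (u : D * D) : exists d, gA (a + delta u.2 - delta u.1) d /\
    c u.1 u.2 *: E u.1 u.2 = d *: E u.1 u.2.
  case: u => p q /=; have Rpq : gR (a + delta p - delta p) (c p q *: E p q).
    rewrite -(mxcomb_coef hE) addrK -[a]addr0 -[a]add0r.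
    by apply: rgradingM (gmxunits_hidem q).1; apply: rgradingM Rx; case: (gmxunits_hidem p).
  rewrite addrK in Rpq.
  have [s [v [us hv cE]]] := homogeneous_decomp gA (c p q).
  set b0 := a + delta q - delta p.
  have Rw b : gR b (v (b - (delta p - delta q)) *: E p q).
    by rewrite -{1}[b](subrK (delta p - delta q)); apply: agradingZ (hv _) (gmxunits_deg hE p q).
  have := homogeneous_sum (s := [seq b + (delta p - delta q) | b <- s]) _ Rw Rpq.
  rewrite map_inj_uniq; last exact: addIr.
  rewrite us big_map {1}cE scaler_suml => /(_ erefl) ->; last first.
    by apply: eq_bigr => b _; rewrite addrK.
  case: ifP => _.
    by exists (v (a - (delta p - delta q))); split=> //; rewrite /b0 opprB addrA.
  by exists 0; rewrite scale0r; split=> //; exact: grading0 (gcompP gA) _.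
exists (fun p q => d (p, q)); split=> [p q|]; first by have [] := hd (p, q).
by apply: eq_bigr => p _; apply: eq_bigr => q _; have [] := hd (p, q).
Qed.

End Family.

Lemma matricial_family (B : set R) : matricial_subalg gR B ->
  exists (D : finType) rep delta (E : D -> D -> R), [/\ gmxunits rep delta E,
    mxfaithful E & forall x, B x <-> exists c, x = mxcomb E c].
Proof.
move=> [l [n [delta [f [fi fg ->]]]]].
pose D : finType := {k : 'I_l.+1 & 'I_(n k).+1}.
pose d (p : D) := delta (tag p) (tagged p).
have f0 : f 0 = 0 := raddf0 f.
have f1 : f 1 = 1 := rmorph1 f.
have fM x y : f (x * y) = f x * f y := rmorphM f x y.
have fc c : f (mxcomb (@munit A l n) c) = mxcomb (fun p q => f (munit A p q)) c.
  rewrite raddf_sum; apply: eq_bigr => p _; rewrite raddf_sum; apply: eq_bigr => q _.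
  exact: linearZ.
exists D, (@mrep l n), d, (fun p q => f (munit A p q)); split; first split.
- have [m1 m2 m3 m4] := @munit_units A l n; split.
  + by move=> p q pq; rewrite (m1 _ _ pq).
  + by move=> p q s pq; rewrite -fM (m2 _ _ _ pq).
  + by move=> p q r s qr; rewrite -fM m3 //; exact: f0.
  + rewrite -f1 -m4; exact/esym/raddf_sum.
- by [].
- move=> p q; apply: fg => k i j; rewrite mxE; case: eqP => [<-|_]; last exact: grading0 (gcompP gA) _.
  case: eqP => [<-|_]; last exact: grading0 (gcompP gA) _.
  rewrite /d /= subrK subrr; exact: rgrading1.
- move=> c p; rewrite -linearZ -f0 => /fi /(congr1 (fun x : mprod A n => x (tag p) (tagged p) (tagged p))).
  rewrite -[X in X = _ -> _]/((c *: munit A p p (tag p)) (tagged p) (tagged p)).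
  rewrite -[X in _ = X -> _]/((0 : 'M[A]_((n (tag p)).+1)) (tagged p) (tagged p)) !mxE.
  by case: p => k i /=; rewrite eqxx mulr1.
- move=> x; split=> [[y _ <-]|[c ->]].
    by exists (mcoef y); rewrite -fc mcoefK.
  by exists (mxcomb (@munit A l n) c).
Qed.

(** The bound [i0] lets the back-and-forth construction advance beyond any prescribed stage. *)
Lemma increasing_finite (B : nat -> set R) (I : finType) (F : I -> R) i0 :
  (forall i, (B i `<=` B i.+1)%classic) -> (forall x, exists i, B i x) ->
  exists2 i, (i0 <= i)%N & forall k, B i (F k).
Proof.
move=> Bi Bt; have mono i j x : (i <= j)%N -> B i x -> B j x.
  move=> /subnK <- Bx; elim: (j - i)%N => // m IH; exact: Bi.
suff [i ii hi] : exists2 i, (i0 <= i)%N & forall k, k \in enum I -> B i (F k).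
  by exists i => // k; apply: hi; rewrite mem_enum.
elim: (enum I) => [|k s [i ii hi]]; first by exists i0.
have [j Bj] := Bt (F k); exists (maxn i j); first by rewrite leq_max ii.
move=> m; rewrite inE => /orP[/eqP->|/hi h].
  exact: mono (leq_maxr _ _) Bj.
exact: mono (leq_maxl _ _) h.
Qed.

(** A matrix has finitely many entries, all in one [B i]; the units found over that matricial
    subalgebra work over [R]. *)
Lemma ultramatricial_regular : graded_field gA -> ultramatricial gR -> mx_regular gR.
Proof.
move=> hA [B [mB Bi Bt]] n eps x hx.
have Bt' y : exists i, B i y.
  have : setT y by []. 
  by rewrite -Bt => -[i _ By]; exists i.
have [i _ hi] := increasing_finite (fun k : 'I_n * 'I_n => x k.1 k.2) 0 Bi Bt'.
have [D [rep [delta [E [hE _ BE]]]]] := matricial_family (mB i).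
have hx' : hspan_mx gA E delta eps x.
  move=> k l; have /BE[c cE] := hi (k, l); have := hx k l.
  rewrite /= in cE; rewrite cE; exact: (degree_hspan hE).
have [u [ui [hu hui uK Ku xux]]] := hspan_mx_unit_regular hE hA hx'.
by exists u, ui; split=> // k l; apply: (hspan_degree hE).
Qed.

End GradedUnits.

(** * Lifting families of matrix units *)

Record posmorph (Gam : zmodType) (R S : pzRingType) (gR : ring_grading Gam R)
    (gS : ring_grading Gam S) (phi : K0gr gR -> K0gr gS) : Prop := PosMorph {
  posmorphD : {morph phi : x y / zadd x y};
  posmorph_act : forall a x, phi (zact a x) = zact a (phi x);
  posmorph_pos : forall x, K0gr_pos x -> K0gr_pos (phi x);
  posmorph_unit : phi (K0gr_unit gR) = K0gr_unit gS }.

Lemma posmorph_sum (Gam : zmodType) (R S : pzRingType) (gR : ring_grading Gam R)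
    (gS : ring_grading Gam S) (phi : K0gr gR -> K0gr gS) (I : Type) (s : seq I) u :
  posmorph phi -> phi (zsum s u) = zsum s (fun i => phi (u i)).
Proof.
move=> hphi; elim: s => [|i s IH] /=; last by rewrite (posmorphD hphi) IH.
by apply: (@zaddI _ _ (phi (zzero _))); rewrite -(posmorphD hphi) zadd0 zadd0r.
Qed.

(** The units are independent, so this is not conjugation. [d] and [s] are linked by [wi * s] and
    [s * vi]: their product is [d] in this order, and in the other order it is [s] because [d] is
    idempotent. *)
Lemma cls_conj (Gam : zmodType) (R : pzRingType) (gR : ring_grading Gam R) d s w wi v vi :
  gR 0 w -> gR 0 wi -> gR 0 v -> gR 0 vi -> wi * w = 1 -> v * vi = 1 -> w * wi = 1 -> vi * v = 1 ->
  hidem gR d -> hidem gR s -> w * d * v = s -> cls gR d = cls gR s.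
Proof.
move=> Rw Rwi Rv Rvi Kw vK wK Kv hd hs wdv.
have dE : d = wi * s * vi by rewrite -wdv !mulrA Kw mul1r -mulrA vK mulr1.
have R0M x y : gR 0 x -> gR 0 y -> gR 0 (x * y).
  by move=> Rx Ry; rewrite -[0]addr0; apply: rgradingM.
apply/esym; apply: (cls_equiv (x := wi * s) (y := s * vi)) => //; try exact: R0M Rwi hs.1.
- exact: R0M hs.1 Rvi.
- by rewrite mulrA -(mulrA wi) hs.2 -dE.
- have := hd.2; rewrite dE => /(congr1 (fun z => w * z * v)).
  rewrite !mulrA wK mul1r -(mulrA _ vi v) Kv mulr1.
  by rewrite -(mulrA _ vi v) Kv mulr1 -!mulrA.
Qed.

(** * Two families of matrix units of the same shape *)

Section Pair.
Variables (Gam : zmodType) (A : comNzRingType) (gA : ring_grading Gam A).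
Variables (R S : algType A) (gR : alg_grading gA R) (gS : alg_grading gA S).
Variables (D : finType) (rep : D -> D) (delta : D -> Gam).
Variables (E : D -> D -> R) (E' : D -> D -> S).
Hypotheses (hE : gmxunits gR rep delta E) (hE' : gmxunits gS rep delta E').

(** [hspan] reads degrees off the coefficients and [delta], so it makes sense in [R * S], where a
    single elimination acts on both families at once. *)
Definition mxpair (p q : D) : (R * S)%type := (E p q, E' p q).

Lemma mxpair_comb c : mxcomb mxpair c = (mxcomb E c, mxcomb E' c).
Proof.
rewrite [LHS]surjective_pairing; congr pair.
  rewrite (raddf_sum (@fst R S)); apply: eq_bigr => p _.
  by rewrite (raddf_sum (@fst R S)).
rewrite (raddf_sum (@snd R S)); apply: eq_bigr => p _.
by rewrite (raddf_sum (@snd R S)).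
Qed.

Lemma mxpair_units : mxunits rep mxpair.
Proof.
have [a1 a2 a3 a4] := gmxunits_units hE; have [b1 b2 b3 b4] := gmxunits_units hE'.
split=> [p q pq|p q s pq|p q r s qr|].
- by rewrite /mxpair a1 // b1.
- by rewrite -[LHS]/(E p q * E q s, E' p q * E' q s) a2 // b2.
- by rewrite -[LHS]/(E p q * E r s, E' p q * E' r s) a3 // b3.
- rewrite [LHS]surjective_pairing (raddf_sum (@fst R S)) (raddf_sum (@snd R S)) /=.
  by rewrite a4 b4.
Qed.

Lemma mxpair_fst a z : hspan gA mxpair delta a z -> hspan gA E delta a z.1.
Proof. by move=> [c [hc ->]]; exists c; rewrite mxpair_comb. Qed.

Lemma mxpair_snd a z : hspan gA mxpair delta a z -> hspan gA E' delta a z.2.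
Proof. by move=> [c [hc ->]]; exists c; rewrite mxpair_comb. Qed.

(** [phi] is known only on the diagonal units. Reducing the pair [z] yields the same list [t] in
    both coordinates, and both classes become sums over [t]. *)
Lemma cls_transfer (phi : K0gr gR -> K0gr gS) (z : (R * S)%type) :
  graded_field gA -> posmorph phi ->
  (forall p, cls gS (E' p p) = phi (cls gR (E p p))) ->
  hidem gR z.1 -> hidem gS z.2 -> hspan gA mxpair delta 0 z ->
  cls gS z.2 = phi (cls gR z.1).
Proof.
move=> hA hphi hcl h1 h2 hz.
have [w [wi [v [vi [t [[hw hwi wK Kw] [hv hvi vK Kv] ut wzv]]]]]] :=
  hspan_diag mxpair_units hA hz.
have [hs cs] : hidem gR (\sum_(p <- t) E p p) /\
    cls gR (\sum_(p <- t) E p p) = zsum t (fun p => cls gR (E p p)).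
  apply: hidem_sum => // [p|p q pq]; first exact: gmxunits_hidem hE p.
  exact: mxunitsM0 (gmxunits_units hE) _ _ _ _ pq.
have [hs' cs'] : hidem gS (\sum_(p <- t) E' p p) /\
    cls gS (\sum_(p <- t) E' p p) = zsum t (fun p => cls gS (E' p p)).
  apply: hidem_sum => // [p|p q pq]; first exact: gmxunits_hidem hE' p.
  exact: mxunitsM0 (gmxunits_units hE') _ _ _ _ pq.
have d1 x : hspan gA mxpair delta 0 x -> gR 0 x.1.
  by move=> /mxpair_fst; apply: hspan_degree hE _ _.
have d2 x : hspan gA mxpair delta 0 x -> gS 0 x.2.
  by move=> /mxpair_snd; apply: hspan_degree hE' _ _.
have e1 : cls gR z.1 = cls gR (\sum_(p <- t) E p p).
  apply: (cls_conj (d1 _ hw) (d1 _ hwi) (d1 _ hv) (d1 _ hvi)) => //.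
  - exact: (congr1 fst Kw).
  - exact: (congr1 fst vK).
  - exact: (congr1 fst wK).
  - exact: (congr1 fst Kv).
  - by rewrite -[LHS]/((w * z * v).1) wzv (raddf_sum (@fst R S)).
have e2 : cls gS z.2 = cls gS (\sum_(p <- t) E' p p).
  apply: (cls_conj (d2 _ hw) (d2 _ hwi) (d2 _ hv) (d2 _ hvi)) => //.
  - exact: (congr1 snd Kw).
  - exact: (congr1 snd vK).
  - exact: (congr1 snd wK).
  - exact: (congr1 snd Kv).
  - by rewrite -[LHS]/((w * z * v).2) wzv (raddf_sum (@snd R S)).
rewrite e1 e2 cs cs' (posmorph_sum _ _ hphi).
by congr zsum; apply: funext => p; rewrite hcl.
Qed.

(** Coefficients agree within blocks by faithfulness, and outside them [E'] vanishes; so sending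
    [mxcomb E c] to [mxcomb E' c] is well defined. *)
Lemma mxcomb_transfer : mxfaithful E ->
  forall c c', mxcomb E c = mxcomb E c' -> mxcomb E' c = mxcomb E' c'.
Proof.
move=> fE c c' cc; apply: eq_bigr => p _; apply: eq_bigr => q _.
have [pq|pq] := eqVneq (rep p) (rep q); last first.
  by rewrite (mxunits_off hE' pq) !scaler0.
congr (_ *: _); apply/eqP; rewrite -subr_eq0; apply/eqP; apply: (fE _ p).
have := congr1 (fun x => E p p * x * E q q) cc; rewrite /= !(mxcomb_coef hE).
move=> /(congr1 (fun x => x * E q p)).
rewrite -!scalerAl (mxunitsM (gmxunits_units hE) _ pq) scalerBl => ->.
by rewrite subrr.
Qed.

End Pair.

Lemma sum_enum (V : nmodType) (I : finType) (F : I -> V) :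
  \sum_i F i = \sum_(i <- enum I) F i.
Proof. by rewrite big_enum. Qed.

Section Lift.
Variables (Gam : zmodType) (A : comNzRingType) (gA : ring_grading Gam A).
Variables (R S : algType A) (gR : alg_grading gA R) (gS : alg_grading gA S).
Variables (D : finType) (rep : D -> D) (delta : D -> Gam).

(** Since [phi] preserves the unit, [1] in [S] splits into orthogonal idempotents [g p] with the
    prescribed classes. Within a block these classes are shifts of one another, which supplies the
    connecting elements. *)
Lemma mxunits_lift (phi : K0gr gR -> K0gr gS) E :
  mx_regular gS -> posmorph phi -> gmxunits gR rep delta E ->
  exists E', gmxunits gS rep delta E' /\ forall p, cls gS (E' p p) = phi (cls gR (E p p)).
Proof.
move=> regS hphi hE.
have EU := gmxunits_units hE.
have hid := gmxunits_hidem hE.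
have [_ c1] : hidem gR (\sum_(p <- enum D) E p p) /\
    cls gR (\sum_(p <- enum D) E p p) = zsum (enum D) (fun p => cls gR (E p p)).
  by apply: hidem_sum => //; [exact: enum_uniq|move=> p q; exact: mxunitsM0 EU _ _ _ _].
rewrite -sum_enum (mxunits1 EU) cls1 in c1.
have c1S : cls gS 1 = zsum (enum D) (fun p => phi (cls gR (E p p))).
  by rewrite cls1 -(posmorph_unit hphi) c1 (posmorph_sum _ _ hphi).
have hpos p : K0gr_pos (phi (cls gR (E p p))) by apply: posmorph_pos hphi _ _; apply: cls_pos.
have [g [hg go gE _]] := cls_splits regS (hidem1 gS) (enum_uniq D) hpos c1S.
rewrite -sum_enum in gE.
have {}hg p : hidem gS (g p) /\ cls gS (g p) = phi (cls gR (E p p)).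
  by apply: hg; rewrite mem_enum.
have {}go p q : p != q -> g p * g q = 0 by apply: go; rewrite mem_enum.
(* Only the units joining [p] to its representative are chosen; the unit at [p], [q] is their
   product through the representative, and the relations follow. *)
have xy p : exists u : S * S, [/\ gS (delta p - delta (rep p)) u.1,
    gS (delta (rep p) - delta p) u.2, u.1 * u.2 = g p, u.2 * u.1 = g (rep p) &
    g p * u.1 * g (rep p) = u.1 /\ g (rep p) * u.2 * g p = u.2].
  have ce : cls gS (g (rep p)) = zact (delta p - delta (rep p)) (cls gS (g p)).
    rewrite (hg _).2 (hg _).2 -(posmorph_act hphi); congr phi.
    have r1 : rep (rep p) = rep p := gmxunits_rep hE p.
    apply: (cls_shift (x := E p (rep p)) (y := E (rep p) p)) => //.
    - exact: gmxunits_deg hE _ _.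
    - rewrite opprB; exact: gmxunits_deg hE _ _.
    - by rewrite (mxunitsM EU).
    - by rewrite (mxunitsM EU).
  have [x [y [Sx Sy xy yx hh]]] := cls_shiftP regS (hg _).1 (hg _).1 ce.
  by exists (x, y); split=> //=; rewrite -opprB.
have {xy}/choice[u hu] := xy.
pose x p := (u p).1; pose y p := (u p).2.
have Sx p : gS (delta p - delta (rep p)) (x p) by case: (hu p).
have Sy p : gS (delta (rep p) - delta p) (y p) by case: (hu p).
have xy p : x p * y p = g p by case: (hu p).
have yx p : y p * x p = g (rep p) by case: (hu p).
have gx p : g p * x p = x p.
  have [_ _ _ _ [hx _]] := hu p.
  by rewrite /x -hx !mulrA (hg p).1.2.
have xg p : x p * g (rep p) = x p.
  have [_ _ _ _ [hx _]] := hu p.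
  by rewrite /x -hx -!mulrA (hg (rep p)).1.2.
have yg p : y p * g p = y p.
  have [_ _ _ _ [_ hx]] := hu p.
  by rewrite /y -hx -!mulrA (hg p).1.2.
exists (fun p q => if rep p == rep q then x p * y q else 0).
have deg p q : gS (delta p - delta q) (if rep p == rep q then x p * y q else 0).
  case: eqP => [pq|_]; last exact: grading0 (gcompP gS) _.
  by have := rgradingM (Sx p) (Sy q); rewrite -pq addrA subrK.
split; last by move=> p; rewrite eqxx xy (hg p).2.
split; [split|exact: gmxunits_rep hE|exact: deg].
- by move=> p q /negPf ->.
- move=> p q s pq; rewrite pq eqxx; case: eqP => [qs|_]; last by rewrite mulr0.
  by rewrite mulrA -(mulrA _ (y q)) yx -pq xg.
- move=> p q r s qr; case: eqP => [_|_]; last by rewrite mul0r.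
  case: eqP => [_|_]; last by rewrite mulr0.
  by rewrite -mulrA -(yg q) -(gx r) -!mulrA (mulrA (g q)) go // mul0r !mulr0.
- by apply: etrans _ (esym gE); apply: eq_bigr => p _; rewrite eqxx xy.
Qed.

End Lift.

(** * Uniqueness of lifts up to conjugation *)

Section Conj.
Variables (Gam : zmodType) (A : comNzRingType) (gA : ring_grading Gam A).
Variables (R : algType A) (gR : alg_grading gA R).
Variables (D : finType) (rep : D -> D) (delta : D -> Gam).

Lemma mxunits_conj E F : mx_regular gR ->
  gmxunits gR rep delta E -> gmxunits gR rep delta F ->
  (forall p, cls gR (E p p) = cls gR (F p p)) ->
  exists u v, [/\ gR 0 u, gR 0 v, u * v = 1, v * u = 1 & forall p q, u * E p q * v = F p q].
Proof.
move=> regR hE hF hc.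
have EU := gmxunits_units hE; have FU := gmxunits_units hF.
have rr p : rep (rep p) = rep p := gmxunits_rep hE p.
have /choice[w hw] p : exists w : R * R, [/\ gR 0 w.1, gR 0 w.2, w.1 * w.2 = F p p,
    w.2 * w.1 = E p p & F p p * w.1 * E p p = w.1 /\ E p p * w.2 * F p p = w.2].
  have ce : cls gR (E p p) = zact 0 (cls gR (F p p)) by rewrite zact0.
  have [x [y [Rx Ry xy yx hh]]] :=
    cls_shiftP regR (gmxunits_hidem hE p) (gmxunits_hidem hF p) ce.
  by exists (x, y); split=> //=; rewrite -oppr0.
pose x p := (w p).1; pose y p := (w p).2.
have Rx p : gR 0 (x p) by case: (hw p).
have Ry p : gR 0 (y p) by case: (hw p).
have xy p : x p * y p = F p p by case: (hw p).
have yx p : y p * x p = E p p by case: (hw p).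
have gx p : F p p * x p = x p.
  have [_ _ _ _ [hx _]] := hw p.
  by rewrite /x -hx !mulrA (mxunits_idem FU).
have yg p : E p p * y p = y p.
  have [_ _ _ _ [_ hx]] := hw p.
  by rewrite /y -hx !mulrA (mxunits_idem EU).
(* Links are taken at representatives and transported along each block, so that the sum of the [a p]
   intertwines [E] with [F]; links chosen separately for each [p] need not do so. *)
pose a p := F p (rep p) * x (rep p) * E (rep p) p.
pose b p := E p (rep p) * y (rep p) * F (rep p) p.
have rM p q z z' : gR p z -> gR q z' -> gR (p + q) (z * z') by apply: rgradingM.
have da p : gR 0 (a p).
  have := rM _ _ _ _ (rM _ _ _ _ (gmxunits_deg hF p (rep p)) (Rx (rep p))) (gmxunits_deg hE (rep p) p).
  by rewrite addr0 addrA subrK subrr.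
have db p : gR 0 (b p).
  have := rM _ _ _ _ (rM _ _ _ _ (gmxunits_deg hE p (rep p)) (Ry (rep p))) (gmxunits_deg hF (rep p) p).
  by rewrite addr0 addrA subrK subrr.
have ab p : a p * b p = F p p.
  rewrite /a /b !mulrA -(mulrA _ (E (rep p) p)) (mxunitsM EU) // -(mulrA _ (E (rep p) (rep p))) yg.
  by rewrite -(mulrA _ (x _)) xy (mxunitsM FU) // (mxunitsM FU).
have ba p : b p * a p = E p p.
  rewrite /a /b !mulrA -(mulrA _ (F (rep p) p)) (mxunitsM FU) // -(mulrA _ (F (rep p) (rep p))) gx.
  by rewrite -(mulrA _ (y _)) yx (mxunitsM EU) // (mxunitsM EU).
have aE p q s : q != p -> a p * E q s = 0.
  by move=> qp; rewrite -mulrA (mxunitsM0 EU) ?mulr0 // eq_sym.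
have ab0 p q : p != q -> a p * b q = 0.
  by move=> pq; rewrite /b !mulrA aE ?mul0r // eq_sym.
have ba0 p q : p != q -> b p * a q = 0.
  by move=> pq; rewrite /b /a !mulrA -(mulrA _ (F _ _) (F _ _)) (mxunitsM0 FU) // mulr0 !mul0r.
have sM (c d : D -> R) (e : D -> R) : (forall p, c p * d p = e p) ->
    (forall p q, p != q -> c p * d q = 0) -> (\sum_p c p) * (\sum_p d p) = \sum_p e p.
  move=> cd cd0; rewrite mulr_suml; apply: eq_bigr => p _.
  rewrite mulr_sumr (bigD1 p) //= cd big1 ?addr0 // => q qp; apply: cd0.
  by rewrite eq_sym.
exists (\sum_p a p), (\sum_p b p); split.
- exact: gcomp_sum.
- exact: gcomp_sum.
- by rewrite (sM _ _ _ ab ab0) (mxunits1 FU).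
- by rewrite (sM _ _ _ ba ba0) (mxunits1 EU).
- move=> p q; rewrite mulr_suml (bigD1 p) //= [X in _ + X]big1 ?addr0; last first.
    by move=> r rp; rewrite aE // eq_sym.
  have Eb r : r != q -> E p q * b r = 0.
    by move=> rq; rewrite /b !mulrA (mxunitsM0 EU) ?mul0r // eq_sym.
  rewrite mulr_sumr (bigD1 q) //= [X in _ + X]big1 ?addr0; last first.
    by move=> r rq; rewrite -mulrA Eb ?mulr0.
  have [pq|pq] := eqVneq (rep p) (rep q); last first.
    by rewrite (mxunits_off EU pq) mulr0 mul0r (mxunits_off FU pq).
  have -> : a p * E p q * b q = F p (rep p) * (x (rep p) * (E (rep p) p * E p q * E q (rep q)) * y (rep q)) * F (rep q) q.
    by rewrite /a /b !mulrA.
  rewrite -pq (mxunitsM EU) // (mxunitsM EU) ?rr -?pq //.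
  by rewrite -(mulrA (x _)) yg xy (mxunitsM FU) // (mxunitsM FU).
Qed.

Lemma gmxunits_conj E u v : gR 0 u -> gR 0 v -> u * v = 1 -> v * u = 1 ->
  gmxunits gR rep delta E ->
  gmxunits gR rep delta (fun p q => u * E p q * v) /\
  forall p, cls gR (u * E p p * v) = cls gR (E p p).
Proof.
move=> Ru Rv uv vu hE; have EU := gmxunits_units hE.
have hF : gmxunits gR rep delta (fun p q => u * E p q * v).
  split; [split|exact: gmxunits_rep hE|].
  - by move=> p q pq; rewrite (mxunits_off EU pq) mulr0 mul0r.
  - move=> p q s pq; rewrite !mulrA -(mulrA _ v u) vu mulr1 -(mulrA u (E p q)) (mxunitsM EU) //.
  - move=> p q r s qr; rewrite !mulrA -(mulrA _ v u) vu mulr1 -(mulrA u (E p q)) (mxunitsM0 EU) //.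
    by rewrite mulr0 mul0r.
  - by rewrite -mulr_suml -mulr_sumr (mxunits1 EU) mulr1.
  - move=> p q; rewrite -[_ - _]addr0 -[_ - _]add0r; apply: rgradingM Rv.
    exact: rgradingM Ru (gmxunits_deg hE p q).
split=> // p; apply/esym.
have Rp := (gmxunits_hidem hE p).1.
apply: (cls_equiv (x := u * E p p) (y := E p p * v)).
- exact: gmxunits_hidem hE p.
- exact: (gmxunits_hidem hF p).
- by rewrite -[0]addr0; apply: rgradingM.
- by rewrite -[0]addr0; apply: rgradingM.
- by rewrite !mulrA -(mulrA u (E p p) (E p p)) (mxunits_idem EU).
- by rewrite !mulrA -(mulrA _ v) vu mulr1 (mxunits_idem EU).
Qed.

End Conj.

(** * The back-and-forth construction *)

(* [Z] is the graph of a homomorphism to [S] from the graded matricial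
   subalgebra [B] of [R], compatible with [phi]. *)
Definition partial_hom (Gam : zmodType) (A : comNzRingType) (gA : ring_grading Gam A)
    (R S : algType A) (gR : alg_grading gA R) (gS : alg_grading gA S)
    (phi : K0gr gR -> K0gr gS) (B : set R) (Z : R -> S -> Prop) : Prop :=
  exists (D : finType) rep delta (E : D -> D -> R) (E' : D -> D -> S),
  [/\ gmxunits gR rep delta E, mxfaithful E /\ (forall x, B x <-> exists c, x = mxcomb E c),
      gmxunits gS rep delta E', (forall p, cls gS (E' p p) = phi (cls gR (E p p))) &
      forall x y, Z x y <-> exists c, x = mxcomb E c /\ y = mxcomb E' c].

Section PartialHom.
Variables (Gam : zmodType) (A : comNzRingType) (gA : ring_grading Gam A).
Variables (R S : algType A) (gR : alg_grading gA R) (gS : alg_grading gA S).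
Variables (phi : K0gr gR -> K0gr gS) (B : set R) (Z : R -> S -> Prop).
Hypothesis hZ : partial_hom phi B Z.

Lemma partial_hom_fun x y y' : Z x y -> Z x y' -> y = y'.
Proof.
have [D [rep [delta [E [E' [hE [fE _] hE' _ ZE]]]]]] := hZ.
move=> /ZE[c [-> ->]] /ZE[c' [cc ->]].
exact: (mxcomb_transfer hE hE' fE).
Qed.

Lemma partial_hom_total x : B x -> exists y, Z x y.
Proof.
have [D [rep [delta [E [E' [hE [_ BE] _ _ ZE]]]]]] := hZ.
by move=> /BE[c ->]; exists (mxcomb E' c); apply/ZE; exists c.
Qed.

Lemma partial_hom_linear a x y x' y' : Z x y -> Z x' y' -> Z (a *: x + x') (a *: y + y').
Proof.
have [D [rep [delta [E [E' [hE [_ BE] _ _ ZE]]]]]] := hZ.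
move=> /ZE[c [-> ->]] /ZE[d [-> ->]]; apply/ZE.
by exists (fun p q => a * c p q + d p q); rewrite !mxcombZ !mxcombD.
Qed.

Lemma partial_hom_mul x y x' y' : Z x y -> Z x' y' -> Z (x * x') (y * y').
Proof.
have [D [rep [delta [E [E' [hE [_ BE] hE' _ ZE]]]]]] := hZ.
move=> /ZE[c [-> ->]] /ZE[d [-> ->]]; apply/ZE.
by rewrite (mxcombM hE) (mxcombM hE'); eexists.
Qed.

Lemma partial_hom1 : Z 1 1.
Proof.
have [D [rep [delta [E [E' [hE [_ BE] hE' _ ZE]]]]]] := hZ.
by apply/ZE; rewrite -(mxcomb1 hE) -(mxcomb1 hE'); eexists.
Qed.

Lemma partial_hom_graded a x y : Z x y -> gR a x -> gS a y.
Proof.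
move=> Zxy Rx; have [D [rep [delta [E [E' [hE _ hE' _ ZE]]]]]] := hZ.
have [c [xE _]] := (ZE x y).1 Zxy.
have [d [hd xE']] : hspan gA E delta a x by rewrite xE in Rx *; apply: degree_hspan hE _ _ Rx.
have Zd : Z x (mxcomb E' d) by apply/ZE; exists d.
rewrite (partial_hom_fun Zxy Zd); apply: (hspan_degree hE').
by exists d.
Qed.

End PartialHom.

Section Step.
Variables (Gam : zmodType) (A : comNzRingType) (gA : ring_grading Gam A).
Hypothesis hA : graded_field gA.
Variables (R S : algType A) (gR : alg_grading gA R) (gS : alg_grading gA S).
Hypotheses (regR : mx_regular gR) (regS : mx_regular gS).
Variables (phi : K0gr gR -> K0gr gS) (psi : K0gr gS -> K0gr gR).
Hypotheses (hphi : posmorph phi) (hpsi : posmorph psi) (phiK : cancel phi psi).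

Lemma partial_hom_start (B : set R) : matricial_subalg gR B -> exists Z, partial_hom phi B Z.
Proof.
move=> /matricial_family[D [rep [delta [E [hE fE BE]]]]].
have [E' [hE' cE']] := mxunits_lift regS hphi hE.
exists (fun x y => exists c, x = mxcomb E c /\ y = mxcomb E' c).
by exists D, rep, delta, E, E'.
Qed.

Variable C : nat -> set S.
Hypotheses (mC : forall j, matricial_subalg gS (C j))
  (Cs : forall j, (C j `<=` C j.+1)%classic) (Ct : forall y, exists j, C j y).

(** Lifting the units of a stage [C j] that contains the image of [B] gives a map to [R]. Its
    composite with the given homomorphism induces the same classes as the inclusion of [B], because
    [psi] inverts [phi]; a conjugation makes it equal to the inclusion. *)
Lemma partial_hom_step B Z j0 : partial_hom phi B Z ->
  exists j (W : S -> R -> Prop), [/\ (j0 <= j)%N, partial_hom psi (C j) W &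
    forall x y, Z x y -> W y x].
Proof.
move=> [D [rep [delta [E [E' [hE [fE BE] hE' cE' ZE]]]]]].
have [j jj hj] := increasing_finite (fun u : D * D => E' u.1 u.2) j0 Cs Ct.
have [D2 [rep2 [delta2 [F [hF fF CF]]]]] := matricial_family (mC j).
have [F' [hF' cF']] := mxunits_lift regR hpsi hF.
have /choice[cc hcc] (u : D * D) : exists c : D2 -> D2 -> A,
    (forall r s, gA (delta u.1 - delta u.2 + delta2 s - delta2 r) (c r s)) /\
    E' u.1 u.2 = mxcomb F c.
  have /CF[c cE] := hj u; have hd := gmxunits_deg hE' u.1 u.2.
  have := degree_hspan hF (a := delta u.1 - delta u.2) (c := c); rewrite -cE.
  by move=> /(_ hd)[d [hd' dE]]; exists d.
have E'E p q : E' p q = mxcomb F (cc (p, q)) by case: (hcc (p, q)).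
(* [G] is the image of [E'] under the map from [F] to [F'] before correction. *)
pose G p q := mxcomb F' (cc (p, q)).
have pairE p q : hspan gA (mxpair F F') delta2 (delta p - delta q) (E' p q, G p q).
  by exists (cc (p, q)); rewrite mxpair_comb -E'E; split=> // r s; case: (hcc (p, q)).
have PU := mxpair_units hF hF'.
(* The span of the pairs is the graph of a map, so relations among the [E'] pass to the [G] by
   uniqueness of the second coordinate. *)
have fn a b y x x' : hspan gA (mxpair F F') delta2 a (y, x) ->
    hspan gA (mxpair F F') delta2 b (y, x') -> x = x'.
  move=> [c [_]]; rewrite mxpair_comb => -[yc ->] [d [_]].
  rewrite mxpair_comb yc => -[cd ->]; exact: (mxcomb_transfer hF hF' fF).
have E'U := gmxunits_units hE'.
have h0 b : hspan gA (mxpair F F') delta2 b (0, 0) by apply: (@hspan0 _ _ gA (S * R)%type).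
have hG : gmxunits gR rep delta G.
  split; [split|exact: gmxunits_rep hE|].
  - move=> p q pq; apply: (fn _ 0 (E' p q) _ _ (pairE p q)).
    by rewrite (mxunits_off E'U pq); exact: (h0 0).
  - move=> p q s pq; have h := hspanM PU (pairE p q) (pairE q s).
    rewrite -[X in hspan _ _ _ _ X]/(E' p q * E' q s, G p q * G q s) in h.
    by rewrite (mxunitsM E'U s pq) in h; apply: (fn _ _ _ _ _ h (pairE p s)).
  - move=> p q r s qr; have h := hspanM PU (pairE p q) (pairE r s).
    rewrite -[X in hspan _ _ _ _ X]/(E' p q * E' r s, G p q * G r s) in h.
    rewrite (mxunitsM0 E'U) // in h.
    exact: (fn _ _ _ _ _ h (h0 0)).
  - apply: (fn 0 0 1); last exact: (hspan1 gA PU delta2).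
    have := @hspan_sum _ _ gA _ _ (mxpair F F') delta2 0 D (index_enum D) (fun p => (E' p p, G p p)).
    rewrite [X in hspan _ _ _ _ X]surjective_pairing.
    rewrite (raddf_sum (@fst S R)) (raddf_sum (@snd S R)) /= (mxunits1 E'U); apply.
    by move=> p; rewrite -[0](subrr (delta p)).
  - move=> p q; apply: (hspan_degree hF'); exact: mxpair_snd (pairE p q).
have cG p : cls gR (G p p) = cls gR (E p p).
  rewrite -[RHS]phiK -cE'.
  apply: (@cls_transfer _ _ _ _ _ _ _ _ _ _ _ _ hF hF' psi (E' p p, G p p)) => //=.
  - exact: gmxunits_hidem hE' p.
  - exact: gmxunits_hidem hG p.
  - by rewrite -[0](subrr (delta p)).
have [u [v [Ru Rv uv vu GE]]] := mxunits_conj regR hG hE cG.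
have [hF2 cF2] := gmxunits_conj Ru Rv uv vu hF'.
exists j, (fun y x => exists c, y = mxcomb F c /\ x = mxcomb (fun p q => u * F' p q * v) c).
split=> //.
  exists D2, rep2, delta2, F, (fun p q => u * F' p q * v).
  by split=> // p; rewrite cF2.
move=> x y /ZE[c [-> ->]].
have conjE d : mxcomb (fun p q => u * F' p q * v) d = u * mxcomb F' d * v.
  rewrite mulr_sumr mulr_suml; apply: eq_bigr => p _.
  rewrite mulr_sumr mulr_suml; apply: eq_bigr => q _.
  by rewrite -scalerAr -scalerAl.
(* Substituting the expansions of the [E' p q] in [F] gives these coefficients; the same ones
   express [mxcomb E c] in the conjugated [F']. *)
exists (fun r s => \sum_(w : D * D) c w.1 w.2 * cc w r s); split.
  rewrite -(mxcomb_sum F (fun w : D * D => c w.1 w.2)) /mxcomb pair_big /=.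
  by apply: eq_bigr => -[p q] _ /=; rewrite E'E.
rewrite -(mxcomb_sum _ (fun w : D * D => c w.1 w.2)) {1}/mxcomb pair_big /=.
by apply: eq_bigr => -[p q] _ /=; rewrite conjE GE.
Qed.

End Step.

Section BackAndForth.
Variables (Gam : zmodType) (A : comNzRingType) (gA : ring_grading Gam A).
Hypothesis hA : graded_field gA.
Variables (R S : algType A) (gR : alg_grading gA R) (gS : alg_grading gA S).
Hypotheses (hR : ultramatricial gR) (hS : ultramatricial gS).
Variables (phi : K0gr gR -> K0gr gS) (psi : K0gr gS -> K0gr gR).
Hypotheses (hphi : posmorph phi) (hpsi : posmorph psi).
Hypotheses (phiK : cancel phi psi) (psiK : cancel psi phi).

Lemma graded_alg_isoI (Z : R -> S -> Prop) :
  (forall x, exists y, Z x y) -> (forall y, exists x, Z x y) ->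
  (forall x y y', Z x y -> Z x y' -> y = y') ->
  (forall x x' y, Z x y -> Z x' y -> x = x') ->
  (forall a x y x' y', Z x y -> Z x' y' -> Z (a *: x + x') (a *: y + y')) ->
  (forall x y x' y', Z x y -> Z x' y' -> Z (x * x') (y * y')) -> Z 1 1 ->
  (forall a x y, Z x y -> gS a y <-> gR a x) ->
  graded_alg_iso gR gS.
Proof.
move=> tl tr fl fr Zl Zm Z1 Zg.
have [f hf] := choice tl; have [g hg] := choice tr.
have lin : linear f by move=> a x y; apply: fl (hf _) (Zl _ _ _ _ _ (hf x) (hf y)).
have mon : monoid_morphism f.
  split; first exact: fl (hf _) Z1.
  by move=> x y; apply: fl (hf _) (Zm _ _ _ _ (hf x) (hf y)).
pose fL := GRing.isLinear.Build A R S *:%R f lin.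
pose fM := GRing.isMonoidMorphism.Build R S f mon.
pose F : {lrmorphism R -> S} := HB.pack f fL fM.
exists F; split; last by move=> a x; apply: Zg; apply: hf.
exists g => x; first exact: fr (hg _) (hf x).
exact: fl (hf _) (hg x).
Qed.

Lemma ultramatricial_iso : graded_alg_iso gR gS.
Proof.
have regR := ultramatricial_regular hA hR; have regS := ultramatricial_regular hA hS.
have [B [mB Bs Bt]] := hR; have [C [mC Cs Ct]] := hS.
have {}Bt x : exists i, B i x by have : setT x by []; rewrite -Bt => -[i _ Bx]; exists i.
have {}Ct y : exists j, C j y by have : setT y by []; rewrite -Ct => -[j _ Cy]; exists j.
pose stage := {p : (R -> S -> Prop) * nat | partial_hom phi (B p.2) p.1}.
(* One round from [R] to [S] and back. The strict inequality makes the indices unbounded, so every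
   [B i] and every [C j] is reached. *)
pose next (s t : stage) := exists j (W : S -> R -> Prop),
  [/\ ((sval s).2 <= j)%N /\ (j < (sval t).2)%N, partial_hom psi (C j) W,
      forall x y, (sval s).1 x y -> W y x & forall x y, W y x -> (sval t).1 x y].
have /choice[F hF] (s : stage) : exists t, next s t.
  case: s => -[Z i] /= hZ.
  have [j [W [ij hW ZW]]] := partial_hom_step hA regR hpsi phiK mC Cs Ct i hZ.
  have [k [Z' [jk hZ' WZ]]] := partial_hom_step hA regS hphi psiK mB Bs Bt j.+1 hW.
  exists (exist _ (Z', k) hZ'), j, W; split=> [|||x y]; [by split|exact: hW|exact: ZW|exact: WZ].
have [Z0 hZ0] := partial_hom_start regS hphi (mB 0).
pose st n := iter n F (exist _ (Z0, 0%N) hZ0 : stage).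
pose Z n := (sval (st n)).1; pose k n := (sval (st n)).2.
have hZ n : partial_hom phi (B (k n)) (Z n) by exact: svalP (st n).
have stS n : next (st n) (st n.+1) by exact: hF.
have nk n : (n <= k n)%N.
  elim: n => // n IH; have [j [W [[kj jk] _ _ _]]] := stS n.
  exact: (leq_ltn_trans (leq_trans IH kj) jk).
have ZS n x y : Z n x y -> Z n.+1 x y.
  by have [j [W [_ _ ZW WZ]]] := stS n; move=> /ZW/WZ.
have mono m n x y : (m <= n)%N -> Z m x y -> Z n x y.
  by move=> /subnK <- Zm; elim: (n - m)%N => // d; apply: ZS.
have Bmono i j x : (i <= j)%N -> B i x -> B j x.
  by move=> /subnK <- Bx; elim: (j - i)%N => // d; apply: Bs.
have Cmono i j x : (i <= j)%N -> C i x -> C j x.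
  by move=> /subnK <- Cx; elim: (j - i)%N => // d; apply: Cs.
have common x y x' y' : (exists n, Z n x y) -> (exists n, Z n x' y') ->
    exists n, Z n x y /\ Z n x' y'.
  move=> [m Zm] [n Zn]; exists (maxn m n).
  by split; [exact: mono (leq_maxl _ _) Zm|exact: mono (leq_maxr _ _) Zn].
apply: (@graded_alg_isoI (fun x y => exists n, Z n x y)).
- move=> x; have [i Bi] := Bt x.
  have [y Zxy] := partial_hom_total (hZ i) (Bmono _ _ _ (nk i) Bi).
  by exists y, i.
- move=> y; have [j Cj] := Ct y; have [j' [W [[kj _] hW _ WZ]]] := stS j.
  have [x Wyx] := partial_hom_total hW (Cmono _ _ _ (leq_trans (nk j) kj) Cj).
  by exists x, j.+1; apply: WZ.
- move=> x y y' h h'; have [n [Zn Zn']] := common _ _ _ _ h h'.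
  exact: (partial_hom_fun (hZ n) Zn Zn').
(* The reversed graph lies in the functional relation [W], so [y] determines [x]. *)
- move=> x x' y h h'; have [n [Zn Zn']] := common _ _ _ _ h h'.
  have [j [W [_ hW ZW _]]] := stS n.
  exact: (partial_hom_fun hW (ZW _ _ Zn) (ZW _ _ Zn')).
- move=> a x y x' y' h h'; have [n [Zn Zn']] := common _ _ _ _ h h'.
  by exists n; apply: (partial_hom_linear (hZ n) a Zn Zn').
- move=> x y x' y' h h'; have [n [Zn Zn']] := common _ _ _ _ h h'.
  by exists n; apply: (partial_hom_mul (hZ n) Zn Zn').
- by exists 0%N; apply: (partial_hom1 (hZ 0)).
- move=> a x y [n Zn]; have [j [W [_ hW ZW _]]] := stS n; split.
    exact: (partial_hom_graded hW (ZW _ _ Zn)).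
  exact: (partial_hom_graded (hZ n) Zn).
Qed.

End BackAndForth.

(** * Morphisms of ordered groups and restriction of scalars *)

Lemma zg_scale_single (Gam : zmodType) (K : zgmodule Gam) (a : Gam)
    (c : {fsfun Gam -> int with 0} := [fsfun [fsfun] with a |-> 1]) (x : K) :
  zg_scale c x = zact a x.
Proof.
have hs : finsupp c = [fset a]%fset by rewrite finsupp_with finsupp0 fsetU0.
have es : enum_fset [fset a]%fset = [:: a].
  apply: perm_small_eq => //; apply: uniq_perm => [||b] //.
  by rewrite -[LHS]/(b \in [fset a]%fset) !inE.
by rewrite /zg_scale hs es /= fsfun_with /= !zadd0r.
Qed.

Lemma zg_linear_act (Gam : zmodType) (K L : zgmodule Gam) (f : K -> L) :
  zg_linear f -> forall a x, f (zact a x) = zact a (f x).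
Proof. by move=> [_ fZ] a x; rewrite -!zg_scale_single fZ. Qed.

Lemma zg_linearI (Gam : zmodType) (K L : zgmodule Gam) (f : K -> L) :
  {morph f : x y / zadd x y >-> zadd x y} -> (forall a x, f (zact a x) = zact a (f x)) ->
  zg_linear f.
Proof.
move=> fD fa; split=> // c x.
have f0 : f (zzero K) = zzero L.
  by apply: (@zaddI _ _ (f (zzero K))); rewrite -fD zadd0 zadd0r.
have fN y : f (zopp y) = zopp (f y).
  by apply: (@zaddI _ _ (f y)); rewrite -fD ![zadd _ (zopp _)]zaddC !zaddN f0.
have fn y n : f (zg_mulrn y n) = zg_mulrn (f y) n.
  by elim: n => [|n IH]; [exact: f0|rewrite /zg_mulrn !iterS fD -/(zg_mulrn _ _) IH].
have fz y m : f (zg_mulrz y m) = zg_mulrz (f y) m.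
  by case: m => n; rewrite /zg_mulrz ?fN fn.
rewrite /zg_scale; elim: (enum_fset _) => [|a s IH]; first exact: f0.
by rewrite [foldr]lock /= -lock fD fz fa IH.
Qed.

Lemma ordered_iso_posmorph (Gam : zmodType) (R S : pzRingType)
    (gR : ring_grading Gam R) (gS : ring_grading Gam S) : K0gr_ordered_iso gR gS ->
  exists (phi : K0gr gR -> K0gr gS) (psi : K0gr gS -> K0gr gR),
  [/\ posmorph phi, posmorph psi, cancel phi psi & cancel psi phi].
Proof.
move=> [f [[g fK gK] lf fpos f1]]; have fact := zg_linear_act lf.
exists f, g; split=> //; split=> //.
- by have [] := lf.
- by move=> x hx; apply/fpos; exists x.
- by move=> x y; apply: (can_inj fK); rewrite lf.1 !gK.
- by move=> a x; apply: (can_inj fK); rewrite fact !gK.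
- by move=> y /fpos[x hx <-]; rewrite fK.
- by rewrite -f1 fK.
Qed.

(** An alias, so that the carrier of [Q] can bear a second module structure, over [R]. *)
Definition resmod (R S : pzRingType) (f : {rmorphism R -> S}) (Q : lmodType S^c) : Type := Q.

Section RestrictionModule.
Variables (R S : pzRingType) (f : {rmorphism R -> S}) (Q : lmodType S^c).
Local Notation M := (resmod f Q).
HB.instance Definition _ := GRing.Zmodule.copy M Q.

Let scale (r : R^c) (x : M) : M := (f (r : R) : S^c) *: (x : Q).

Fact res_scaleA a b x : scale a (scale b x) = scale (a * b) x.
Proof. by rewrite /scale scalerA; congr (_ *: _); rewrite [RHS](rmorphM f). Qed.
Fact res_scale1 : left_id 1 scale.
Proof. by move=> x; rewrite /scale [X in X *: _](rmorph1 f) scale1r. Qed.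
Fact res_scaleDr : right_distributive scale +%R.
Proof. by move=> a x y; apply: scalerDr. Qed.
Fact res_scaleDl x : {morph scale^~ x : a b / a + b}.
Proof. by move=> a b; rewrite /scale [X in X *: _](rmorphD f) scalerDl. Qed.
HB.instance Definition _ := GRing.Zmodule_isLmodule.Build R^c M
  res_scaleA res_scale1 res_scaleDr res_scaleDl.

Lemma res_scaleE (r : R^c) (x : M) : r *: x = ((f (r : R) : S^c) *: (x : Q)) :> Q.
Proof. by []. Qed.

End RestrictionModule.

Section Restriction.
Variables (Gam : zmodType) (R S : pzRingType).
Variables (gR : ring_grading Gam R) (gS : ring_grading Gam S).
Variables (f : {rmorphism R -> S}) (fg : forall a x, gR a x -> gS a (f x)).

Definition res (Q : gmod gS) : gmod gR :=
  @GMod _ _ gR (resmod f Q) (@Grading _ (resmod f Q) (gm_gr Q) (gcompP (gm_gr Q)))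
    (fun a b x r hx hr => gm_act hx (fg hr)).

Lemma res_linear (P Q : gmod gS) (h : P -> Q) : linear h -> linear (h : res P -> res Q).
Proof. by move=> lh a x y; apply: lh. Qed.

Lemma res_hom (P Q : gmod gS) (h : P -> Q) :
  graded_hom h -> @graded_hom _ _ gR (res P) (res Q) h.
Proof. by move=> [lh hh]; split=> //; apply: res_linear. Qed.

Lemma res_iso (P Q : gmod gS) : gmod_iso P Q -> gmod_iso (res P) (res Q).
Proof. by move=> [h [lh bh hh]]; exists h; split=> //; apply: res_linear. Qed.

Lemma res_dsum (P Q : gmod gS) : gmod_iso (res (dsum P Q)) (dsum (res P) (res Q)).
Proof. by exists id; split=> //; exists id. Qed.

Lemma res_shift a (P : gmod gS) : gmod_iso (res (gmod_shift a P)) (gmod_shift a (res P)).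
Proof. by exists id; split=> //; exists id. Qed.

Lemma res_gmod0 : gmod_iso (res (gmod0 gS)) (gmod0 gR).
Proof.
exists (fun=> 0); split=> [a x y||a x]; first by rewrite scaler0 addr0.
  by exists (fun=> 0) => x; apply/rowP; case.
by split.
Qed.

End Restriction.

Section RestrictionIso.
Variables (Gam : zmodType) (R S : pzRingType).
Variables (gR : ring_grading Gam R) (gS : ring_grading Gam S).
Variables (f : {rmorphism R -> S}) (fg : forall a x, gR a x -> gS a (f x)).
Variables (g : {rmorphism S -> R}) (gg : forall a x, gS a x -> gR a (g x)).
Hypotheses (fK : cancel f g) (gK : cancel g f).

Lemma res_fg (Q : gmod gS) : fingen Q -> fingen (res fg Q).
Proof.
move=> [n [q hq]]; exists n, q => x; have [r rE] := hq x.
exists (fun i => (g (r i : S) : R^c)); rewrite {1}rE.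
by apply: eq_bigr => i _; rewrite res_scaleE gK.
Qed.

(** A lifting problem over [R] is restricted along [g], solved over [S], and the solution is
    [R]-linear because [g (f a) = a]. *)
Lemma res_proj (Q : gmod gS) : graded_projective Q -> graded_projective (res fg Q).
Proof.
move=> pQ M N k h [lk hk] sk [lh hh].
have h' : @graded_hom _ _ gS Q (res gg N) h.
  split=> // a x y; rewrite -{1}[a](gK (a : S)) -[LHS]/(h ((g (a : S) : R^c) *: (x : res fg Q) + y)).
  exact: lh.
have [t [[lt ht] kt]] := pQ _ _ _ _ (res_hom gg (conj lk hk)) sk h'.
exists t; split=> //; split=> // a x y.
by rewrite -[LHS]/(t ((f (a : R) : S^c) *: (x : Q) + y)) lt res_scaleE fK.
Qed.

Definition res_gproj (Q : gproj gS) : gproj gR :=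
  GProj (res_fg (gp_fg Q)) (res_proj (@gp_proj _ _ _ Q)).

Lemma res_reg : gmod_iso (res_gproj (gproj_reg gS)) (gproj_reg gR).
Proof.
exists (fun x : S => g x : R); split.
- move=> a x y; have aux (b : R) (u v : S) : g (u * f b + v) = g u * b + g v.
    by rewrite rmorphD rmorphM fK.
  exact: aux.
- by exists f.
- move=> a x; split; last exact: gg.
  by move=> /fg; rewrite gK.
Qed.

Definition vres (u : vgr gS) : vgr gR := qclass (gproj_iso gR) (res_gproj (qrepr u)).

Lemma vresE P : vres (qclass (gproj_iso gS) P) = qclass (gproj_iso gR) (res_gproj P).
Proof. by apply/qclass_eq; apply: res_iso; apply: (qreprE (gproj_iso gS) P). Qed.

Lemma vresD : {morph vres : u v / madd u v}.
Proof.
move=> u v; have [P ->] := Defs.quotP u; have [Q ->] := Defs.quotP v.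
by rewrite /= vgr_addE !vresE vgr_addE; apply/qclass_eq; apply: res_dsum.
Qed.

Lemma vres_act a u : vres (mact a u) = mact a (vres u).
Proof.
have [P ->] := Defs.quotP u.
by rewrite /= vgr_actE !vresE vgr_actE; apply/qclass_eq; apply: res_shift.
Qed.

Lemma vres0 : vres (mzero (vgr gS)) = mzero (vgr gR).
Proof. by rewrite [LHS]vresE; apply/qclass_eq; apply: res_gmod0. Qed.

Definition kres (u : K0gr gS) : K0gr gR :=
  qclass (gc_equiv (vgr gR)) (vres (qrepr u).1, vres (qrepr u).2).

Lemma kresE x : kres (qclass (gc_equiv (vgr gS)) x) = qclass (gc_equiv (vgr gR)) (vres x.1, vres x.2).
Proof.
apply/qclass_eq; have [k h] := qreprE (gc_equiv (vgr gS)) x; exists (vres k).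
by have := congr1 vres h; rewrite !vresD.
Qed.

Lemma kresD : {morph kres : u v / zadd u v}.
Proof.
move=> u v; have [x ->] := Defs.quotP u; have [y ->] := Defs.quotP v.
by rewrite /= gc_addE !kresE gc_addE /= !vresD.
Qed.

Lemma kres_act a u : kres (zact a u) = zact a (kres u).
Proof. by have [x ->] := Defs.quotP u; rewrite /= gc_actE !kresE gc_actE /= !vres_act. Qed.

Lemma kres_class P : kres (K0gr_class P) = K0gr_class (res_gproj P).
Proof. by rewrite [LHS]kresE /= vresE vres0. Qed.

End RestrictionIso.

Section RestrictionInverse.
Variables (Gam : zmodType) (R S : pzRingType).
Variables (gR : ring_grading Gam R) (gS : ring_grading Gam S).
Variables (f : {rmorphism R -> S}) (fg : forall a x, gR a x -> gS a (f x)).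
Variables (g : {rmorphism S -> R}) (gg : forall a x, gS a x -> gR a (g x)).
Hypotheses (fK : cancel f g) (gK : cancel g f).

Lemma res_resK (P : gmod gR) : gmod_iso (res fg (res gg P)) P.
Proof.
exists id; split=> //; last by exists id.
move=> a x y; congr (_ + _).
by rewrite -[LHS]/((g (f (a : R)) : R^c) *: (x : P)) fK.
Qed.

Lemma vresK u : vres fg gg fK gK (vres gg fg gK fK u) = u.
Proof.
by have [P ->] := Defs.quotP u; rewrite !vresE; apply/qclass_eq; apply: res_resK.
Qed.

Lemma kresK u : kres fg gg fK gK (kres gg fg gK fK u) = u.
Proof. by have [[x y] ->] := Defs.quotP u; rewrite !kresE /= !vresK. Qed.

End RestrictionInverse.

Lemma graded_ring_iso_K0 (Gam : zmodType) (R S : pzRingType)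
    (gR : ring_grading Gam R) (gS : ring_grading Gam S)
    (f : {rmorphism R -> S}) (g : {rmorphism S -> R}) :
  (forall a x, gR a x -> gS a (f x)) -> (forall a x, gS a x -> gR a (g x)) ->
  cancel f g -> cancel g f -> K0gr_ordered_iso gR gS.
Proof.
(* Restriction is contravariant: the map from the group of [R] to that of [S] is restriction along
   the inverse [g]. *)
move=> fg gg fK gK; exists (kres gg fg gK fK); split.
- by exists (kres fg gg fK gK) => u; apply: kresK.
- exact: (zg_linearI (kresD gg fg gK fK) (kres_act gg fg gK fK)).
- move=> y; split=> [[P ->]|[_ [P ->] <-]]; last by rewrite kres_class; eexists.
  exists (kres fg gg fK gK (K0gr_class P)); last exact: kresK.
  by rewrite kres_class; eexists.
- by rewrite /K0gr_unit kres_class; apply: K0gr_class_iso; apply: res_reg.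
Qed.

Theorem theorem5p2p4 (Gam : zmodType) (A : comNzRingType)
    (gA : ring_grading Gam A) (hA : graded_field gA)
    (R S : algType A) (gR : alg_grading gA R) (gS : alg_grading gA S)
    (hR : ultramatricial gR) (hS : ultramatricial gS) :
  graded_alg_iso gR gS <-> K0gr_ordered_iso gR gS.
Proof.
split=> [[f [[g fK gK] hf]]|/ordered_iso_posmorph[phi [psi [hphi hpsi phiK psiK]]]].
  have fB u v : f (u - v) = f u - f v := rmorphB f u v.
  have f1 : f 1 = 1 := rmorph1 f.
  have fM u v : f (u * v) = f u * f v := rmorphM f u v.
  have gD : zmod_morphism g by move=> x y; apply: (can_inj fK); rewrite fB !gK.
  have gM : monoid_morphism g.
    split; first by apply: (can_inj fK); rewrite f1 gK.
    by move=> x y; apply: (can_inj fK); rewrite fM !gK.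
  pose gb := GRing.isZmodMorphism.Build S R g gD.
  pose gm := GRing.isMonoidMorphism.Build S R g gM.
  pose G : {rmorphism S -> R} := HB.pack g gb gm.
  apply: (@graded_ring_iso_K0 _ _ _ gR gS f G) => //.
    by move=> a x /hf.
  by move=> a x Sx; apply/hf; rewrite /= gK.
exact: (ultramatricial_iso hA hR hS hphi hpsi phiK psiK).
Qed.
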